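(* For each $m\in\mathbb{N}$ there exists a universal constant $K_m<\infty$ (depending only on $m$) such that the following holds. Let $n\ge m$, $p>1$, and, for all $\mathbf{i}=(i_1,\dots,i_m)\in\{1,\dots,n\}^m$, let $h_{\mathbf{i}}:S^m\to\mathbb{R}$ be a nonnegative measurable function of $m$ variables whose $p$-th power is integrable for the law of $(X_{i_1}^{(1)},\dots,X_{i_m}^{(m)})$. Let $$t_0=\inf\Bigl[t\ge 0:\ \Pr\Bigl\{\sum_{\mathbf{i}}h_{\mathbf{i}}>t\Bigr\}\le\frac{1}{2^{(p+1)/(p-1)}K_m^{p/(p-1)}}\Bigr].$$ Then $$\frac{1}{(4K_m)^{p/(p-1)}}\,t_0^p\ \vee\ \max_{J\subseteq\{1,\dots,m\},\,J\ne\emptyset}\Bigl[E_J\max_{\mathbf{i}_J}\Bigl(\sum_{\mathbf{i}_{J^c}}E_{J^c}h_{\mathbf{i}}\Bigr)^p\Bigr]\le E\Bigl(\sum_{\mathbf{i}}h_{\mathbf{i}}\Bigr)^p$$ $$\le(4K_m)^{p}\Bigl\{2^{1+p}t_0^p+\sum_{J\subseteq\{1,\dots,m\},\,J\ne\emptyset}\Bigl[p^{|J|p}E_J\max_{\mathbf{i}_J}\Bigl(\sum_{\mathbf{i}_{J^c}}E_{J^c}h_{\mathbf{i}}\Bigr)^p\Bigr]\Bigr\}.$$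
   Context: The random variables $X_i^{(j)}$, $1\le i\le n$, $1\le j\le m$, $m\le n$, are independent (not necessarily with the same distribution) and take values in a measurable space $(S,\mathcal{S})$. Inside expectations, probabilities and sums, $h_{\mathbf{i}}$ stands for the random variable $h_{i_1,\dots,i_m}(X_{i_1}^{(1)},\dots,X_{i_m}^{(m)})$, and $\sum_{\mathbf{i}}$ is the sum over all $\mathbf{i}\in\{1,\dots,n\}^m$. For $J\subseteq\{1,\dots,m\}$, $J^c$ is its complement in $\{1,\dots,m\}$; $\mathbf{i}_J\in\{1,\dots,n\}^{|J|}$ is obtained from $\mathbf{i}$ by deleting the coordinates in places not in $J$; $\sum_{\mathbf{i}_J}$ and $\max_{\mathbf{i}_J}$ are the sum and the maximum over $1\le i_j\le n$, $j\in J$ (the coordinates not in $J$ being fixed), with $\sum_{\mathbf{i}_\emptyset}a=a$. $E$ is expectation with respect to all variables; $E_J$ is expectation only with respect to the variables $X_i^{(j)}$ with $j\in J$, $1\le i\le n$ (the others being held fixed), with $E_\emptyset a=a$. $a\vee b=\max(a,b)$. *)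

(* Defs.v *)
From HB Require Import structures.
From mathcomp Require Import all_boot all_order all_algebra.
From mathcomp Require Import all_classical all_reals all_analysis.
Import Order.TTheory GRing.Theory Num.Theory.
Import numFieldNormedType.Exports.

Set Implicit Arguments.
Unset Strict Implicit.
Unset Printing Implicit Defensive.

Local Open Scope classical_set_scope.
Local Open Scope ring_scope.

Definition mutually_independent (d d' : measure_display)
    (T : measurableType d) (S : measurableType d') (R : realType)
    (P : probability T R) (I : finType) (X : I -> T -> S) : Prop :=
  forall (A : {set I}) (B : I -> set S), (forall i, measurable (B i)) ->
    P (\bigcap_(i in [set` A]) (X i @^-1` B i)) =
    (\prod_(i in A) P (X i @^-1` B i))%E.

(* Multi-indices (i_1, ..., i_m) in {1, ..., n}^m. *)
Notation multi_index m n := {ffun 'I_m -> 'I_n}.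

(* Partial sum and maximum over the coordinates in [J], the coordinates of [i]
   not in [J] being held fixed: the result only depends on the latter.  The
   range contains [i], so the neutral element -oo never shows up in the
   maximum. *)
Definition sum_over (R : realType) (m n : nat) (J : {set 'I_m})
    (F : multi_index m n -> \bar R) (i : multi_index m n) : \bar R :=
  (\sum_(k : multi_index m n | [forall j in ~: J, k j == i j]) F k)%E.

Definition max_over (R : realType) (m n : nat) (J : {set 'I_m})
    (F : multi_index m n -> \bar R) (i : multi_index m n) : \bar R :=
  (\big[maxe/-oo]_(k : multi_index m n | [forall j in ~: J, k j == i j]) F k)%E.

Section decoupled.
Context (d d' : measure_display) (T : measurableType d) (S : measurableType d').
Context (R : realType) (P : probability T R) (m n : nat).
Variable X : 'I_m -> 'I_n -> {RV P >-> S}.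

Definition selected (i : multi_index m n) : T -> m.-tuple S :=
  fun w => [tuple X j (i j) w | j < m].

Lemma measurable_selected (i : multi_index m n) :
  measurable_fun setT (selected i).
Proof.
apply/measurable_fun_tnthP => j.
rewrite (_ : _ \o _ = X j (i j)); first exact: measurable_funPT.
by apply/funext => w /=; rewrite tnth_mktuple.
Qed.

HB.instance Definition _ (i : multi_index m n) :=
  isMeasurableFun.Build _ _ _ _ (selected i) (measurable_selected i).

(* The integrand [F] is a function of the values y_i^(j) = [y j i] of all the
   variables.  Those with j in [J] are replaced by the random variables and
   averaged, those with j not in [J] are held fixed at [x]. *)
Definition E_over (J : {set 'I_m}) (F : ('I_m -> 'I_n -> S) -> \bar R)
    (x : 'I_m -> 'I_n -> S) : \bar R :=
  (\int[P]_w F (fun j i => if j \in J then X j i w else x j i))%E.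

Definition h_at (h : multi_index m n -> m.-tuple S -> R) (i : multi_index m n)
    (x : 'I_m -> 'I_n -> S) : R :=
  h i [tuple x j (i j) | j < m].

Definition h_sum (h : multi_index m n -> m.-tuple S -> R) (w : T) : R :=
  \sum_(i : multi_index m n) h_at h i (fun j k => X j k w).

(* E_J max_{i_J} (sum_{i_{J^c}} E_{J^c} h_i)^p.  The value depends neither on
   [i0] nor on [x0]: after the inner operations only the coordinates in [J]
   are left, and the outer ones act on exactly these. *)
Definition mixed_moment (h : multi_index m n -> m.-tuple S -> R) (p : R)
    (i0 : multi_index m n) (x0 : 'I_m -> 'I_n -> S) (J : {set 'I_m}) : \bar R :=
  E_over J (fun x =>
    max_over J (fun i =>
      poweR (sum_over (~: J) (fun k =>
        E_over (~: J) (fun y => (h_at h k y)%:E) x) i) p) i0) x0.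

Definition t_zero (h : multi_index m n -> m.-tuple S -> R) (p K : R) : R :=
  inf [set t : R | 0 <= t /\
    (P [set w | (h_sum h w > t)%R]
      <= (1 / (2 `^ ((p + 1) / (p - 1)) * K `^ (p / (p - 1))))%:E)%E].

End decoupled.

(* Main.v *)
(* Each coordinate j in 1..m indexes a block of independent variables, so an
   estimate for one sum of independent nonnegative variables F_k can be iterated
   over the coordinates:
     (A) E (sum F_k)^p <= C^p ((sum E F_k)^p + p^p sum E F_k^p),
   obtained by writing (sum F)^p = sum_k F_k (sum F)^(p-1), separating F_k from
   the independent remainder and absorbing.  This bounds E (sum h)^p by the
   quantities p^(|J| p) sum_(i_J) E_J (sum_(i_J^c) E_J^c h)^p.  To turn the sums
   over i_J into maxima, one coordinate at a time, use
     (B) a^p sum E F_k^p <= 4 a (a^p E max F_k^p + (sum E F_k)^p)  (a >= 1)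
   with a = p^|J|.  The error terms are dominated by moments of the decoupled sum
   with one coordinate averaged out, which are handled by induction on the number
   of coordinates.  The remaining term (E sum h)^p is either dominated by the
   others, or E (sum h)^p <= 2 K^p (E sum h)^p and the Paley-Zygmund inequality
   gives E sum h <= 2 t_0; this is where the threshold defining t_0 comes from.
   The lower bounds are Markov's and Jensen's inequalities. *)
Require Import Defs.
From HB Require Import structures.
From mathcomp Require Import all_boot all_order all_algebra.
From mathcomp Require Import ring lra.
From mathcomp Require Import all_classical all_reals all_analysis.
From mathcomp Require Import measurable_realfun.
Import Order.TTheory GRing.Theory Num.Theory.
Import numFieldNormedType.Exports.
Local Open Scope classical_set_scope.
Local Open Scope ring_scope.

Set Implicit Arguments.
Unset Strict Implicit.
Unset Printing Implicit Defensive.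

(** * The space of finite configurations *)

(** Every constant has to be the p-th power of a number depending on [m] alone; only the weights
    p^(|J| p) may grow faster. In (A) this works because (1 + 1/p)^(p-1) <= e. In (B) the loss 4 a =
    4 p^|J| is unbounded in p, but p <= e^p turns it into at most (4 e^m)^p.

    Sums over i_J cannot be exchanged for maxima in one stroke: summands with different i_J may
    share a variable, whereas for a single coordinate j, with the other blocks frozen, those with
    different i_j are independent. So the intermediate quantities carry a sum over some coordinates
    and a maximum over others, and each exchange leaves an error in which coordinate j is averaged.
    This is why the moments are set up for arbitrary sets of averaged coordinates and the induction
    runs on the size of the set of those left random.

    Integrals take values in [0, +oo], so exchanging expectations never needs integrability; within
    the iteration, finiteness enters only where a moment is absorbed or a truncation level is
    chosen. *)

Definition box {I : finType} {d : measure_display} {S : measurableType d}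
    (B : I -> set S) : set (I -> S) := [set x | forall i, B i (x i)].

(** Boxes are closed under intersection and generate the finite product sigma-algebra, so a law on
    configurations is fixed by its values on boxes, and these are what mutual independence
    prescribes. *)
Definition boxes (I : finType) (d : measure_display) (S : measurableType d) :
    set (set (I -> S)) :=
  [set box B | B in [set B : I -> set S | forall i, measurable (B i)]].

Notation config I S := (g_sigma_algebraType (@boxes I _ S)).

Definition mix {I : finType} {S : Type} (U : {set I}) (y x : I -> S) : I -> S :=
  fun i => if i \in U then y i else x i.

Definition depends_on {I : finType} {S V : Type} (U : {set I})
    (F : (I -> S) -> V) : Prop :=
  forall x y, {in U, x =1 y} -> F x = F y.

Section configurations.
Context {I : finType} {d : measure_display} {S : measurableType d}.

Lemma mixT (y x : I -> S) : mix [set: I]%SET y x = y.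
Proof. by apply/funext => i; rewrite /mix inE. Qed.

Lemma depends_on_mix (V : Type) (U W : {set I}) (F : (I -> S) -> V) y x :
  depends_on W F -> [disjoint U & W]%B -> F (mix U y x) = F x.
Proof.
move=> FW dUW; apply: FW => i iW; rewrite /mix.
by rewrite (disjointFl dUW iW).
Qed.

Lemma depends_onS (V : Type) (U W : {set I}) (F : (I -> S) -> V) :
  U \subset W -> depends_on U F -> depends_on W F.
Proof. by move=> /fintype.subsetP UW FU x y xy; apply: FU => i /UW; exact: xy. Qed.

Lemma measurable_box (B : I -> set S) :
  (forall i, measurable (B i)) -> measurable (box B : set (config I S)).
Proof. by move=> mB; apply: sub_sigma_algebra; exists B. Qed.

Lemma measurable_coord (i : I) :
  measurable_fun setT (fun x : config I S => x i).
Proof.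
move=> _ A mA; rewrite setTI.
rewrite (_ : _ @^-1` _ = box (fun j => if j == i then A else setT)).
  by apply: measurable_box => j; case: ifP.
apply/seteqP; split => x /= Ax; first by move=> j; case: eqP => // ->.
by have := Ax i; rewrite eqxx.
Qed.

Lemma measurable_to_config {d'} {T : measurableType d'} (f : T -> config I S) :
  (forall i, measurable_fun setT (fun t => f t i)) -> measurable_fun setT f.
Proof.
move=> mf; apply: (@measurability _ _ _ (config I S) _ _ (@boxes I _ S)) => // _ [_ [B mB <-] <-].
rewrite setTI (_ : _ @^-1` _ =
    \bigcap_(i in [set: I]) ((fun t => f t i) @^-1` B i)); last first.
  by apply/seteqP; split => t /= ft i; [move=> _|]; exact: ft.
apply: fin_bigcap_measurable => // i _.
by rewrite -[_ @^-1` _]setTI; exact: mf.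
Qed.

Lemma measurable_mix (U : {set I}) {d'} {T : measurableType d'}
    (f g : T -> config I S) :
  measurable_fun setT f -> measurable_fun setT g ->
  measurable_fun setT (fun t => mix U (f t) (g t) : config I S).
Proof.
move=> mf mg; apply: measurable_to_config => i; rewrite /mix.
by case: (i \in U); apply: (measurableT_comp (measurable_coord i)).
Qed.

Lemma boxes_setI_closed : setI_closed (@boxes I _ S).
Proof.
move=> _ _ [B mB <-] [C mC <-]; exists (fun i => B i `&` C i).
  by move=> i; exact: measurableI.
apply/seteqP; split => x /=; first by move=> BC; split => i; have [] := BC i.
by move=> [Bx Cx] i; split; [exact: Bx|exact: Cx].
Qed.

Lemma measure_box_unique {R : realType}
    (mu nu : {measure set (config I S) -> \bar R}) :
  (mu setT < +oo)%E ->
  (forall B, (forall i, measurable (B i)) -> mu (box B) = nu (box B)) ->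
  forall A : set (config I S), measurable A -> mu A = nu A.
Proof.
move=> muT munu A mA.
have boxT : box (fun=> setT : set S) = setT :> set (I -> S).
  by apply/seteqP; split.
apply: (@measure_unique _ _ (config I S) (@boxes I _ S) (fun=> setT)) => //.
- exact: boxes_setI_closed.
- by move=> _; exists (fun=> setT).
- by rewrite bigcup_const//; exists 0%N.
- by move=> _ [B mB <-]; exact: munu.
Qed.

End configurations.

(** On this class Tonelli's theorem and the linearity of the integral hold without integrability
    conditions. *)
Definition nneg_measurable {d} {T : measurableType d} {R : realType}
    (f : T -> \bar R) : Prop :=
  measurable_fun [set: T] f /\ forall t, (0 <= f t)%E.

Section nneg_measurable_closure.
Context {d} {T : measurableType d} {R : realType}.
Local Open Scope ereal_scope.
Implicit Types f g : T -> \bar R.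

Lemma nneg_measurable_cst (c : \bar R) :
  0 <= c -> nneg_measurable (fun _ : T => c).
Proof. by move=> c0; split => //; exact: measurable_cst. Qed.

Lemma nneg_measurableM f g :
  nneg_measurable f -> nneg_measurable g -> nneg_measurable (fun t => f t * g t).
Proof.
move=> [mf f0] [mg g0]; split; first exact: emeasurable_funM.
by move=> t; rewrite mule_ge0.
Qed.

Lemma nneg_measurableD f g :
  nneg_measurable f -> nneg_measurable g -> nneg_measurable (fun t => f t + g t).
Proof.
move=> [mf f0] [mg g0]; split; first exact: emeasurable_funD.
by move=> t; rewrite adde_ge0.
Qed.

Lemma nneg_measurableZ (r : R) f : (0 <= r)%R ->
  nneg_measurable f -> nneg_measurable (fun t => r%:E * f t).
Proof.
by move=> r0; apply: nneg_measurableM; apply: nneg_measurable_cst; rewrite lee_fin.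
Qed.

Lemma nneg_measurable_sum (I : Type) (s : seq I) (Q : pred I)
    (f : I -> T -> \bar R) : (forall i, nneg_measurable (f i)) ->
  nneg_measurable (fun t => \sum_(i <- s | Q i) f i t).
Proof.
move=> mf; split; last by move=> t; apply: sume_ge0 => i _; exact: (mf i).2.
under eq_fun do rewrite big_mkcond.
apply: emeasurable_sum => i; case: (Q i); last exact: measurable_cst.
exact: (mf i).1.
Qed.

Lemma nneg_measurable_powR f (r : R) :
  nneg_measurable f -> nneg_measurable (fun t => f t `^ r).
Proof.
move=> [mf f0]; split; last by move=> t; rewrite poweR_ge0.
exact: (measurableT_comp (measurable_poweR r)).
Qed.

Lemma nneg_measurable_max (I : Type) (s : seq I) (Q : pred I)
    (f : I -> T -> \bar R) : (forall i, nneg_measurable (f i)) ->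
  nneg_measurable (fun t => \big[maxe/0]_(i <- s | Q i) f i t).
Proof.
move=> mf; elim: s => [|i s IHs].
  by under eq_fun do rewrite big_nil; exact: nneg_measurable_cst.
under eq_fun do rewrite big_cons.
case: (Q i) => //.
split; last by move=> t; rewrite le_max (mf i).2.
by apply: measurable_maxe; [exact: (mf i).1|exact: IHs.1].
Qed.

Lemma nneg_measurable_if (b : T -> bool) f g : measurable_fun setT b ->
  nneg_measurable f -> nneg_measurable g ->
  nneg_measurable (fun t => if b t then f t else g t).
Proof.
move=> mb [mf f0] [mg g0]; split; first exact: measurable_fun_ifT.
by move=> t; case: (b t).
Qed.

Lemma nneg_measurable_comp {d'} {U : measurableType d'} f (g : U -> T) :
  nneg_measurable f -> measurable_fun setT g ->
  nneg_measurable (fun u => f (g u)).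
Proof. by move=> [mf f0] mg; split => //; exact: measurableT_comp mf mg. Qed.

End nneg_measurable_closure.

(** * Averaging over a set of independent coordinates *)

Section average.
Context {d d' : measure_display} {T : measurableType d} {S : measurableType d'}.
Context {R : realType} (P : probability T R) {I : finType}.
Variable X : I -> {RV P >-> S}.
Local Open Scope ereal_scope.
Implicit Types (U V W : {set I}) (F G : config I S -> \bar R) (x : config I S).

Definition sample (w : T) : config I S := fun i => X i w.

(** Under independence this is the conditional expectation given the coordinates outside [U],
    realised as a function defined everywhere: those coordinates are read from [x], the ones in [U]
    from the sample. *)
Definition average U F x : \bar R := \int[P]_w F (mix U (sample w) x).

Lemma measurable_sample : measurable_fun setT sample.
Proof. by apply: measurable_to_config => i; exact: measurable_funPT. Qed.

Lemma measurable_mix_sample U x :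
  measurable_fun setT (fun w => mix U (sample w) x : config I S).
Proof.
by apply: measurable_mix; [exact: measurable_sample|exact: measurable_cst].
Qed.

Lemma nneg_measurable_mix U F x : nneg_measurable F ->
  nneg_measurable (fun w => F (mix U (sample w) x)).
Proof. by move=> mF; apply: (nneg_measurable_comp mF); exact: measurable_mix_sample. Qed.

Lemma nneg_measurable_average U F :
  nneg_measurable F -> nneg_measurable (average U F).
Proof.
move=> mF; split; last by move=> x; apply: integral_ge0 => w _; exact: mF.2.
have mG : nneg_measurable (fun z : config I S * T => F (mix U (sample z.2) z.1)).
  apply: (nneg_measurable_comp mF).
  apply: measurable_mix => //; apply: measurableT_comp => //.
  exact: measurable_sample.
exact: (measurable_fun_fubini_tonelli_F (m2 := P) _ mG.1 mG.2).
Qed.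

Lemma average_ge0 U F x : (forall y, 0 <= F y) -> 0 <= average U F x.
Proof. by move=> F0; apply: integral_ge0 => w _; exact: F0. Qed.

Lemma average_le U F G x : nneg_measurable F -> nneg_measurable G ->
  (forall y, F y <= G y) -> average U F x <= average U G x.
Proof.
move=> mF mG FG; apply: ge0_le_integral => //=.
- by move=> w _; exact: mF.2.
- exact: (nneg_measurable_mix _ _ mF).1.
- exact: (nneg_measurable_mix _ _ mG).1.
Qed.

Lemma averageD U F G x : nneg_measurable F -> nneg_measurable G ->
  average U (fun y => F y + G y) x = average U F x + average U G x.
Proof.
move=> mF mG; rewrite /average ge0_integralD//.
- by move=> w _; exact: mF.2.
- exact: (nneg_measurable_mix _ _ mF).1.
- by move=> w _; exact: mG.2.
- exact: (nneg_measurable_mix _ _ mG).1.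
Qed.

Lemma average_sum U (K : Type) (s : seq K) (Q : pred K)
    (F : K -> config I S -> \bar R) x : (forall k, nneg_measurable (F k)) ->
  average U (fun y => \sum_(k <- s | Q k) F k y) x =
  \sum_(k <- s | Q k) average U (F k) x.
Proof.
move=> mF; rewrite /average big_mkcond/=.
under eq_integral do rewrite big_mkcond/=.
rewrite ge0_integral_sum//=.
- by apply: eq_bigr => k _; case: ifP => // _; rewrite integral0.
- move=> k; case: (Q k); last exact: measurable_cst.
  exact: (nneg_measurable_mix _ _ (mF k)).1.
- by move=> k w _; case: ifP => // _; exact: (mF k).2.
Qed.

Lemma averageZ U (c : \bar R) F x : 0 <= c -> nneg_measurable F ->
  average U (fun y => c * F y) x = c * average U F x.
Proof.
move=> c0 mF; rewrite /average ge0_integralZl//.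
- exact: (nneg_measurable_mix _ _ mF).1.
- by move=> w _; exact: mF.2.
Qed.

Lemma average_cst U (c : \bar R) x : average U (fun=> c) x = c.
Proof.
rewrite /average integral_cst// [X in _ * X](_ : _ = 1) ?mule1//.
exact: probability_setT.
Qed.

Lemma average_disjoint U W F x :
  depends_on W F -> [disjoint U & W]%B -> average U F x = F x.
Proof.
move=> FW dUW; rewrite -[RHS](average_cst U _ x).
by apply: eq_integral => w _; rewrite (depends_on_mix _ _ FW dUW).
Qed.

Lemma average_set0 F x : average finset.set0 F x = F x.
Proof.
apply: (@average_disjoint _ [set: I]%SET); first by move=> y z yz; congr F; apply/funext => i; exact: yz.
by apply: eq_disjoint0 => i; rewrite inE.
Qed.

Lemma depends_on_average U W F :
  depends_on W F -> depends_on (W :\: U) (average U F).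
Proof.
move=> FW x y xy; apply: eq_integral => w _; apply: FW => i iW; rewrite /mix.
by case: (boolP (i \in U)) => // iU; apply: xy; rewrite inE iU.
Qed.

Hypothesis indepX : mutually_independent P (fun i => X i : T -> S).

Lemma probability_sample_box U (B : I -> set S) :
  (forall i, measurable (B i)) ->
  P (\bigcap_(i in [set` U]) (X i @^-1` B i)) = \prod_(i in U) P (X i @^-1` B i).
Proof. exact: indepX. Qed.

(** Tonelli for independent blocks. The left side draws two independent samples, one per block, the
    right side a single one; independence gives the two substituted configurations [phi] and [psi]
    the same law, which is checked on boxes. *)
Lemma average_average U V F x : nneg_measurable F -> [disjoint U & V]%B ->
  average U (average V F) x = average (U :|: V) F x.
Proof.
move=> mF dUV.
pose phi (z : T * T) : config I S := mix V (sample z.2) (mix U (sample z.1) x).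
pose psi (w : T) : config I S := mix (U :|: V) (sample w) x.
have mphi : measurable_fun setT phi.
  apply: measurable_mix; last apply: measurable_mix.
  - by apply: measurableT_comp => //; exact: measurable_sample.
  - by apply: measurableT_comp => //; exact: measurable_sample.
  - exact: measurable_cst.
have mpsi : measurable_fun setT psi by exact: measurable_mix_sample.
have mFphi := nneg_measurable_comp mF mphi.
transitivity (\int[P \x P]_z F (phi z)).
  by rewrite (fubini_tonelli1 (fun z => F (phi z)) mFphi.1 mFphi.2).
transitivity (\int[pushforward (P \x P) phi]_y F y).
  rewrite ge0_integral_pushforward//; first exact: mF.1.
  by move=> y _; exact: mF.2.
transitivity (\int[pushforward P psi]_y F y); last first.
  rewrite ge0_integral_pushforward//; first exact: mF.1.
  by move=> y _; exact: mF.2.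
pose phi' : {mfun _ >-> _} := HB.pack phi (isMeasurableFun.Build _ _ _ _ _ mphi).
pose psi' : {mfun _ >-> _} := HB.pack psi (isMeasurableFun.Build _ _ _ _ _ mpsi).
apply: (@eq_measure_integral _ _ _ _ (pushforward P psi') (pushforward (P \x P) phi')) => A mA _.
apply/esym/(@measure_box_unique _ _ _ _ (pushforward P psi') (pushforward (P \x P) phi')) => //=.
  by rewrite /pushforward preimage_setT probability_setT ltry.
move=> B mB; rewrite /pushforward /=.
have mXB i : measurable (X i @^-1` B i).
  by rewrite -[_ @^-1` _]setTI; exact: measurable_funPT.
have mcap W : measurable (\bigcap_(i in [set` W]) (X i @^-1` B i)).
  by apply: fin_bigcap_measurable => // i _; exact: mXB.
(* Coordinates outside [U :|: V] are constant: if one of them misses its side of the box, both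
   preimages are empty. *)
have [xB|] := pselect (forall i, i \notin U :|: V -> B i (x i)); last first.
  move=> xB.
  have noB y : ~ box B (mix (U :|: V) y x).
    by apply: contra_not xB => yB i iUV; have := yB i; rewrite /mix (negbTE iUV).
  have -> : psi @^-1` box B = set0 by rewrite -subset0 => w; exact: noB.
  suff -> : phi @^-1` box B = set0 by rewrite !measure0.
  rewrite -subset0 => -[w1 w2] /= B12; apply: xB => i.
  have := B12 i; rewrite /phi /mix /= inE negb_or => + /andP[/negbTE iU /negbTE iV].
  by rewrite iU iV.
have -> : psi @^-1` box B = \bigcap_(i in [set` U :|: V]) (X i @^-1` B i).
  apply/seteqP; split => w /= wB i.
    by move=> /= iUV; have := wB i; rewrite /psi /mix iUV.
  rewrite /psi /mix; case: ifPn => iUV; last exact: xB.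
  exact: wB.
have -> : phi @^-1` box B = (\bigcap_(i in [set` U]) (X i @^-1` B i)) `*`
    (\bigcap_(i in [set` V]) (X i @^-1` B i)).
  apply/seteqP; split => [[w1 w2] /= wB|[w1 w2] /= [w1B w2B] i].
    split => i /= iW; have := wB i; rewrite /phi /mix /= iW//.
    by rewrite (disjointFr dUV iW).
  rewrite /phi /mix /=; case: ifPn => iV; first exact: w2B.
  case: ifPn => iU; first exact: w1B.
  by apply: xB; rewrite inE negb_or iU.
rewrite product_measure1E// probability_sample_box//.
transitivity ((\prod_(i in U) P (X i @^-1` B i)) *
    (\prod_(i in V) P (X i @^-1` B i))); last first.
  by congr (_ * _); apply/esym/probability_sample_box.
by rewrite -bigU//=; apply: eq_bigl => i; rewrite !inE.
Qed.

(** Integrate over [U :\: V] first: [F] does not see these coordinates and factors out. The averaged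
    [G] then no longer depends on them, nor on [U :&: V] by disjointness, so it factors out of the
    second integration. [F] and [G] may still share coordinates outside [U], which stay fixed. *)
Lemma average_mul U V W F G x : nneg_measurable F -> nneg_measurable G ->
  depends_on V F -> depends_on W G -> [disjoint U :&: V & W]%B ->
  average U (fun y => F y * G y) x = average U F x * average U G x.
Proof.
move=> mF mG FV GW dVW.
rewrite -[in LHS](finset.setID U V) -[in X in X * _](finset.setID U V) -[in X in _ * X](finset.setID U V).
have d1 : [disjoint U :&: V & U :\: V]%B.
  by rewrite -setI_eq0; apply/eqP/setP => i; rewrite !inE; case: (i \in V); rewrite ?andbF.
have d2 : [disjoint U :\: V & V]%B.
  by rewrite -setI_eq0; apply/eqP/setP => i; rewrite !inE; case: (i \in V); rewrite ?andbF.
have d3 : [disjoint U :&: V & W :\: (U :\: V)]%B.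
  by apply: disjointWr dVW; exact: subsetDl.
rewrite -!average_average//; last exact: nneg_measurableM.
have mG' := nneg_measurable_average (U :\: V) mG.
rewrite (_ : average (U :\: V) (fun y => F y * G y) =
    fun y => average (U :\: V) G y * F y); last first.
  apply/funext => y; rewrite muleC -averageZ//; last exact: mF.2.
  by apply: eq_integral => w _; rewrite (depends_on_mix _ _ FV d2).
rewrite (_ : average (U :\: V) F = F); last first.
  by apply/funext => y; rewrite (average_disjoint _ FV).
rewrite [in RHS](average_disjoint _ (depends_on_average GW) d3) muleC.
transitivity (average (U :&: V) (fun y => average (U :\: V) G x * F y) x);
  last by apply: averageZ => //; exact: mG'.2.
apply: eq_integral => w _.
by rewrite (depends_on_mix _ _ (depends_on_average GW) d3).
Qed.

End average.

(** * Powers of extended nonnegative reals *)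

Section power_inequalities.
Context {R : realType}.
Local Open Scope ereal_scope.
Implicit Types (x y : \bar R) (p r : R).

Lemma le_poweR x y r : (0 <= r)%R -> 0 <= x -> x <= y -> x `^ r <= y `^ r.
Proof.
move=> r0 x0 xy; apply: gt0_ler_poweR => //; rewrite in_itv/= leey andbT//.
exact: le_trans xy.
Qed.

Lemma mule_poweRB1 x p : (1 < p)%R -> 0 <= x -> x * x `^ (p - 1) = x `^ p.
Proof.
move=> p1 x0; rewrite -{1}(poweRe1 x0) -poweRD; first by rewrite addrC subrK.
apply: add_neq0_poweRD_def.
by rewrite addrC subrK gt_eqF// (lt_trans _ p1).
Qed.

(** A crude Young inequality: replace the smaller of [x] and [y] by the larger. *)
Lemma mule_poweRB1_le x y p : (1 < p)%R -> 0 <= x -> 0 <= y ->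
  x * y `^ (p - 1) <= x `^ p + y `^ p.
Proof.
move=> p1 x0 y0; have q0 : (0 <= p - 1)%R by rewrite subr_ge0 ltW.
have [xy|/ltW yx] := leP x y.
  apply: le_trans (leeDr _ (poweR_ge0 x p)); rewrite -(mule_poweRB1 p1 y0).
  by rewrite lee_wpmul2r// poweR_ge0.
apply: le_trans (leeDl _ (poweR_ge0 y p)); rewrite -(mule_poweRB1 p1 x0).
by rewrite lee_wpmul2l// le_poweR.
Qed.

Lemma powR_1Dinv_le p : (1 < p)%R -> ((1 + p^-1) `^ (p - 1) <= expR 1)%R.
Proof.
move=> p1; have p0 : (0 < p)%R by rewrite (lt_trans _ p1).
rewrite /powR gt_eqF; last by rewrite addr_gt0// invr_gt0.
rewrite ler_expR (@le_trans _ _ ((p - 1) * p^-1)%R)//.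
  apply: ler_wpM2l; first by rewrite subr_ge0 ltW.
  by apply: le_ln1Dx; rewrite (lt_le_trans (ltrN10 R))// invr_ge0 ltW.
by rewrite mulrBl mulfV ?gt_eqF// mul1r gerBl invr_ge0 ltW.
Qed.

Lemma powR_exprn (a r : R) (k : nat) :
  (0 <= a)%R -> ((a ^+ k) `^ r = (a `^ r) ^+ k)%R.
Proof. by move=> a0; rewrite -!powR_mulrn ?powR_ge0// -!powRrM mulrC. Qed.

Lemma le_powR1 (a p : R) : (1 < p)%R -> (1 <= a)%R -> (a <= a `^ p)%R.
Proof.
by move=> p1 a1; rewrite -{1}(powRr1 (le_trans ler01 a1)) ler_powR// ltW.
Qed.

(* Either y <= x / p or x < p y, hence x + y <= (1 + 1 / p) x or
   x + y <= (1 + p) y. *)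
Lemma poweRB1_split x y p : (1 < p)%R -> 0 <= x -> 0 <= y ->
  (x + y) `^ (p - 1) <=
  (expR 1)%:E * x `^ (p - 1) + ((2 * p) `^ p)%:E * y `^ (p - 1).
Proof.
move=> p1 x0 y0; have q0 : (0 <= p - 1)%R by rewrite subr_ge0 ltW.
have p0 : (0 < p)%R by rewrite (lt_trans _ p1).
have ip0 : (0 <= p^-1)%R by rewrite invr_ge0 ltW.
have [yx|xy] := leP (p%:E * y) x.
  rewrite (@le_trans _ _ ((expR 1)%:E * x `^ (p - 1)))//; last first.
    by rewrite leeDl// mule_ge0 ?poweR_ge0// lee_fin powR_ge0.
  rewrite (@le_trans _ _ (((1 + p^-1)%:E * x) `^ (p - 1)))//.
    rewrite le_poweR ?adde_ge0// EFinD ge0_muleDl ?lee_fin// mul1e leeD2l//.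
    rewrite (@le_trans _ _ (p^-1%:E * (p%:E * y)))//.
      by rewrite muleA -EFinM mulVf ?gt_eqF// mul1e.
    by rewrite lee_wpmul2l// lee_fin.
  rewrite poweRM// ?lee_fin ?addr_ge0// lee_wpmul2r ?poweR_ge0// lee_fin.
  exact: powR_1Dinv_le.
rewrite (@le_trans _ _ (((2 * p) `^ p)%:E * y `^ (p - 1)))//; last first.
  by rewrite leeDr// mule_ge0 ?poweR_ge0// lee_fin expR_ge0.
rewrite (@le_trans _ _ (((1 + p)%:E * y) `^ (p - 1)))//.
  apply: le_poweR => //; first exact: adde_ge0.
  rewrite EFinD ge0_muleDl ?lee_fin ?(ltW p0)//.
  by rewrite mul1e addeC leeD2l// ltW.
rewrite poweRM// ?lee_fin ?addr_ge0 ?(ltW p0)//.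
rewrite lee_wpmul2r ?poweR_ge0// lee_fin.
rewrite (@le_trans _ _ ((2 * p) `^ (p - 1))%R)//.
  by rewrite ge0_ler_powR// ?nnegrE; lra.
by rewrite ler_powR//; lra.
Qed.

(** Each term is at most the l^p norm of the family. The constant is crude; the bound only serves to
    show that moments of sums are finite. *)
Lemma poweR_sum_le (K : finType) (Q : pred K) (f : K -> \bar R) p :
  (0 < p)%R -> (forall k, 0 <= f k) ->
  (\sum_(k | Q k) f k) `^ p <=
  (#|K|%:R `^ p)%:E * \sum_(k | Q k) f k `^ p.
Proof.
move=> p0 f0; have q0 : (0 <= p^-1)%R by rewrite invr_ge0 ltW.
set z := \sum_(k | Q k) f k `^ p.
have z0 : 0 <= z by apply: sume_ge0 => k _; exact: poweR_ge0.
have fz k : Q k -> f k <= z `^ p^-1.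
  move=> Qk; have -> : f k = (f k `^ p) `^ p^-1.
    by rewrite -poweRrM mulfV ?gt_eqF// poweRe1.
  rewrite le_poweR ?poweR_ge0// /z (bigD1 k)//= leeDl//.
  by apply: sume_ge0 => l _; exact: poweR_ge0.
rewrite (@le_trans _ _ ((#|K|%:R%:E * z `^ p^-1) `^ p))//.
  rewrite le_poweR ?(ltW p0)//; first exact: sume_ge0.
  rewrite (@le_trans _ _ (\sum_(k | Q k) z `^ p^-1))//; first exact: lee_sum.
  rewrite (@le_trans _ _ (\sum_(k : K) z `^ p^-1))//.
    rewrite [leLHS]big_mkcond/= lee_sum// => k _.
    by case: (Q k) => //; exact: poweR_ge0.
  by rewrite sumr_const mule_natl; exact: lexx.
by rewrite poweRM ?poweR_ge0// -poweRrM mulVf ?gt_eqF// poweRe1.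
Qed.

(** With z the total sum, f^p = f f^(p-1) <= f z^(p-1) for each term. In [key] the induction runs
    over partial sums while z stays fixed. *)
Lemma sum_poweR_le (K : Type) (s : seq K) (Q : pred K) (f : K -> \bar R) p :
  (1 < p)%R -> (forall k, 0 <= f k) ->
  \sum_(k <- s | Q k) f k `^ p <= (\sum_(k <- s | Q k) f k) `^ p.
Proof.
move=> p1 f0; set z := \sum_(k <- s | Q k) f k.
have z0 : 0 <= z by exact: sume_ge0.
have key (t : seq K) : \sum_(k <- t | Q k) f k <= z ->
    \sum_(k <- t | Q k) f k `^ p <= (\sum_(k <- t | Q k) f k) * z `^ (p - 1).
  elim: t => [|k t IHt]; first by rewrite !big_nil mul0e.
  rewrite !big_cons; case: (Q k) => // fkz.
  rewrite ge0_muleDl//; last exact: sume_ge0.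
  rewrite leeD//; last by apply: IHt; apply: le_trans fkz; rewrite leeDr.
  rewrite -mule_poweRB1// lee_wpmul2l// le_poweR ?subr_ge0 ?(ltW p1)//.
  by rewrite (le_trans _ fkz)// leeDl// sume_ge0.
by rewrite (le_trans (key s _))// /z mule_poweRB1.
Qed.

End power_inequalities.

(** * Sums of independent nonnegative variables *)

Section independent_sums.
Context {d d' : measure_display} {T : measurableType d} {S : measurableType d'}.
Context {R : realType} (P : probability T R) {I : finType}.
Variable X : I -> {RV P >-> S}.
Hypothesis indepX : mutually_independent P (fun i => X i : T -> S).
Local Open Scope ereal_scope.
Local Notation average := (average X).

Context {K : finType} (Q : pred K) (U : {set I}) (W : K -> {set I}).
Variable F : K -> config I S -> \bar R.
(** Separation is required only among the averaged coordinates: the [F k] may share coordinates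
    outside [U], so they are independent conditionally on these. *)
Hypothesis disjW : forall k l, Q k -> Q l -> k != l ->
  [disjoint U :&: W k & W l]%B.
Hypothesis mF : forall k, nneg_measurable (F k).
Hypothesis FW : forall k, depends_on (W k) (F k).

Let W' k := (\bigcup_(l | Q l && (l != k)) W l)%SET.

Let disjW' k : Q k -> [disjoint U :&: W k & W' k]%B.
Proof.
move=> Qk; apply: bigcup_disjoint => l /andP[Ql lk].
by rewrite disjW// eq_sym.
Qed.

Let FW' k l : Q l && (l != k) -> depends_on (W' k) (F l).
Proof. by move=> Ql; apply: (depends_onS _ (@FW l)); exact: finset.bigcup_sup. Qed.

Lemma average_sum_poweR (p : R) x : (1 < p)%R ->
  average U (fun y => (\sum_(k | Q k) F k y) `^ p) x <=
  ((4 * expR 1) `^ p)%:E * ((\sum_(k | Q k) average U (F k) x) `^ p +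
    (p `^ p)%:E * \sum_(k | Q k) average U (fun y => F k y `^ p) x).
Proof.
move=> p1; have p0 : (0 < p)%R by rewrite (lt_trans _ p1).
pose s y := \sum_(k | Q k) F k y.
pose s' k y := \sum_(l | Q l && (l != k)) F l y.
have F0 k y : 0 <= F k y by exact: (mF k).2.
have s0 y : 0 <= s y by exact: sume_ge0.
have s'0 k y : 0 <= s' k y by exact: sume_ge0.
have ms : nneg_measurable s by exact: nneg_measurable_sum.
have ms' k : nneg_measurable (s' k) by exact: nneg_measurable_sum.
set A := \sum_(k | Q k) average U (F k) x.
set Z := \sum_(k | Q k) average U (fun y => F k y `^ p) x.
set V := average U _ x.
pose Y := average U (fun y => s y `^ (p - 1)) x.
have A0 : 0 <= A by apply: sume_ge0 => k _; apply: average_ge0 => y; exact: (mF k).2.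
have mFp k r : nneg_measurable (fun y => F k y `^ r) by exact: nneg_measurable_powR.
have Z0 : 0 <= Z by apply: sume_ge0 => k _; apply: average_ge0 => y; exact: (mFp k _).2.
have V0 : 0 <= V by apply: average_ge0 => y; exact: poweR_ge0.
have e1 : (1 <= expR 1 :> R)%R by rewrite -expR0 ler_expR.
have C0 : (0 < (4 * expR 1) `^ p :> R)%R by rewrite powR_gt0//; lra.
(* An infinite [Z] makes the right side infinite. Otherwise the crude bound makes [V] finite, as the
   absorption requires. *)
have [->|Zfin] := eqVneq Z +oo.
  rewrite gt0_muley ?lte_fin ?powR_gt0// addey.
    by rewrite gt0_muley ?lte_fin// leey.
  by rewrite gt_eqF// (lt_le_trans _ (poweR_ge0 _ _)).
have Vfin : V \is a fin_num.
  rewrite ge0_fin_numE// (@le_lt_trans _ _ ((#|K|%:R `^ p)%:E * Z))//.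
    rewrite /Z -average_sum// -averageZ ?lee_fin ?powR_ge0//; last first.
      exact: nneg_measurable_sum.
    apply: average_le; first exact: nneg_measurable_powR.
      by apply: nneg_measurableZ; [exact: powR_ge0|exact: nneg_measurable_sum].
    by move=> y; exact: poweR_sum_le.
  by rewrite lte_mul_pinfty ?lee_fin ?powR_ge0// ltey.
have mM k : nneg_measurable (fun y => F k y * s' k y `^ (p - 1)).
  by apply: nneg_measurableM => //; exact: nneg_measurable_powR.
pose D := ((2 * p) `^ p)%R.
have D0 : (0 <= D)%R by exact: powR_ge0.
(* Expand s^p into the terms [F k] times s^(p-1), where s = [s' k] + [F k]. By [poweRB1_split] one
   part pairs [F k] with a power of the independent [s' k]; the other is a multiple of the p-th
   power of [F k]. *)
have VAY : V <= (expR 1)%:E * (A * Y) + D%:E * Z.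
  rewrite (@le_trans _ _ (average U (fun y => \sum_(k | Q k)
      ((expR 1)%:E * (F k y * s' k y `^ (p - 1)) + D%:E * F k y `^ p)) x))//.
    apply: average_le; first exact: nneg_measurable_powR.
      apply: nneg_measurable_sum => k; apply: nneg_measurableD.
        by apply: nneg_measurableZ; [exact: expR_ge0|exact: mM].
      exact: nneg_measurableZ.
    move=> y /=; rewrite -/(s y) -(mule_poweRB1 p1 (s0 y)) {1}/s ge0_sume_distrl//.
    apply: lee_sum => k Qk.
    have -> : s y = s' k y + F k y by rewrite /s (bigD1 k)//= addeC.
    apply: (le_trans (lee_wpmul2l _ (poweRB1_split p1 _ _))) => //.
    rewrite ge0_muleDr ?mule_ge0 ?poweR_ge0 ?lee_fin ?expR_ge0//.
    by rewrite muleCA leeD2l// muleCA mule_poweRB1.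
  rewrite average_sum; last first.
    move=> k; apply: nneg_measurableD.
      by apply: nneg_measurableZ; [exact: expR_ge0|exact: mM].
    exact: nneg_measurableZ.
  have aF0 k : 0 <= average U (F k) x by apply: average_ge0.
  have Y0 : 0 <= Y by apply: average_ge0 => y; exact: poweR_ge0.
  rewrite /A /Z ge0_sume_distrl; last by move=> k _; exact: aF0.
  rewrite ge0_sume_distrr; last by move=> k _; exact: mule_ge0.
  rewrite ge0_sume_distrr; last by move=> k _; apply: average_ge0 => y; exact: poweR_ge0.
  rewrite -big_split/=; apply: lee_sum => k Qk.
  rewrite averageD; last 2 first.
  - by apply: nneg_measurableZ; [exact: expR_ge0|exact: mM].
  - exact: nneg_measurableZ.
  rewrite !averageZ ?lee_fin ?expR_ge0// leeD2r//.
  rewrite lee_wpmul2l ?lee_fin ?expR_ge0//.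
  have sW' : depends_on (W' k) (fun y => s' k y `^ (p - 1)).
    by move=> y z yz; congr (_ `^ _); apply: eq_bigr => l Ql; exact: FW' yz.
  rewrite (average_mul indepX x (mF k) _ (@FW k) sW' (disjW' Qk)); last first.
    exact: nneg_measurable_powR.
  rewrite lee_wpmul2l//.
  apply: average_le; [exact: nneg_measurable_powR|exact: nneg_measurable_powR|].
  move=> y; rewrite le_poweR ?subr_ge0 ?(ltW p1)//.
  by rewrite /s (bigD1 k)//= leeDr.
have e2 : (0 <= 2 * expR 1 :> R)%R by lra.
have e4 : (0 <= 4 * expR 1 :> R)%R by lra.
have e24 : (2 * expR 1 <= 4 * expR 1 :> R)%R by lra.
have p0' : (0 <= p)%R by exact: ltW.
have DB : (2 * D <= (4 * expR 1) `^ p * p `^ p)%R.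
  rewrite /D [((2 * p) `^ p)%R]powRM// mulrA ler_wpM2r ?powR_ge0//.
  apply: (@le_trans _ _ (2 `^ p * 2 `^ p)%R).
    rewrite ler_wpM2r ?powR_ge0// -{1}(powRr1 (ler0n R 2)) ler_powR ?(ltW p1)//.
    by rewrite ler1n.
  by rewrite -powRM// ge0_ler_powR ?nnegrE//; lra.
(* [B] is twice the coefficient of [Y] in [VAY]. Averaging B s^(p-1) <= B^p + s^p bounds B Y by B^p
   + V, hence 2 V <= B^p + V + 2 D Z, and one copy of the finite [V] cancels. *)
pose B := (2 * expR 1)%:E * A.
have B0 : 0 <= B by rewrite mule_ge0 ?lee_fin.
have BY : B * Y <= B `^ p + V.
  rewrite -averageZ//; last exact: nneg_measurable_powR.
  rewrite -[B `^ p](average_cst X U _ x) -averageD//; last 2 first.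
  - by apply: nneg_measurable_cst; exact: poweR_ge0.
  - exact: nneg_measurable_powR.
  apply: average_le.
  - by apply: nneg_measurableM; [exact: nneg_measurable_cst|exact: nneg_measurable_powR].
  - apply: nneg_measurableD; last exact: nneg_measurable_powR.
    by apply: nneg_measurable_cst; exact: poweR_ge0.
  - by move=> y; exact: mule_poweRB1_le.
have Y0 : 0 <= Y by apply: average_ge0 => y; exact: poweR_ge0.
clearbody V Y A Z.
have {VAY BY} VB : V <= B `^ p + (2 * D)%:E * Z.
  rewrite -(leeD2rE _ _ Vfin) addeAC.
  apply: (@le_trans _ _ (2%:E * ((expR 1)%:E * (A * Y) + D%:E * Z))).
    by rewrite mule_natl mule2n leeD.
  rewrite ge0_muleDr ?mule_ge0 ?lee_fin ?expR_ge0//.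
  by rewrite !muleA -!EFinM -/B leeD2r.
apply: (le_trans VB).
rewrite ge0_muleDr ?mule_ge0 ?poweR_ge0 ?lee_fin ?powR_ge0//.
rewrite leeD//.
  rewrite /B poweRM ?lee_fin//.
  by rewrite lee_wpmul2r ?poweR_ge0// lee_fin ge0_ler_powR ?nnegrE.
by rewrite muleA lee_wpmul2r// -EFinM lee_fin.
Qed.

(* With [r = E max F_k^p] and [D^p = 2 r], the event that no F_l with
   [l != k] exceeds [D] has probability at least 1/2 and is independent of
   F_k.  The events that F_k is the only one exceeding [D] are disjoint, so
   the part of [sum_k E F_k^p] above [D] is at most [2 r]. *)
Lemma sum_average_poweR_le (p a : R) x : (1 < p)%R -> (1 <= a)%R ->
  (a `^ p)%:E * \sum_(k | Q k) average U (fun y => F k y `^ p) x <=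
  (4 * a)%:E * ((a `^ p)%:E *
      average U (fun y => \big[maxe/0]_(k | Q k) F k y `^ p) x +
    (\sum_(k | Q k) average U (F k) x) `^ p).
Proof.
move=> p1 a1; have p0 : (0 < p)%R by rewrite (lt_trans _ p1).
have a0 : (0 < a)%R by rewrite (lt_le_trans _ a1).
have F0 k y : 0 <= F k y by exact: (mF k).2.
have mFp k r : nneg_measurable (fun y => F k y `^ r) by exact: nneg_measurable_powR.
pose M y := \big[maxe/0]_(k | Q k) F k y `^ p.
have mM : nneg_measurable M by exact: nneg_measurable_max.
have FM k y : Q k -> F k y `^ p <= M y.
  by move=> Qk; exact: (le_bigmax_cond _ (fun k => F k y `^ p)).
set A := \sum_(k | Q k) average U (F k) x.
have A0 : 0 <= A by apply: sume_ge0 => k _; exact: average_ge0.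
have m0 : 0 <= average U M x by apply: average_ge0; exact: mM.2.
have ap0 : (0 < a `^ p)%R by exact: powR_gt0.
have R0 : 0 <= (4 * a)%:E * ((a `^ p)%:E * average U M x + A `^ p).
  rewrite mule_ge0 ?lee_fin ?mulr_ge0 ?(ltW a0)// adde_ge0 ?poweR_ge0//.
  by rewrite mule_ge0// lee_fin ltW.
(* The truncation level needs 0 < r < +oo. An infinite mean of [M] makes the right side infinite; a
   zero mean makes every term on the left zero. *)
case: (ltgtP (average U M x) 0) => [|mpos|m_eq0].
- by rewrite ltNge m0.
- have [moo|mfin] := eqVneq (average U M x) +oo.
    rewrite -/M moo gt0_muley ?lte_fin// addye; last first.
      by rewrite gt_eqF// (lt_le_trans _ (poweR_ge0 _ _)).
    by rewrite gt0_muley ?leey// lte_fin mulr_gt0.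
  have [r rE] : exists r, average U M x = r%:E.
    by exists (fine (average U M x)); rewrite fineK// ge0_fin_numE// ltey.
  rewrite -/M rE; move: mpos; rewrite rE lte_fin => r0.
  pose D := ((2 * r) `^ p^-1)%R.
  have r20 : (0 < 2 * r)%R by rewrite mulr_gt0.
  have D0 : (0 < D)%R by exact: powR_gt0.
  have Dp : (D `^ p = 2 * r)%R.
    by rewrite /D -powRrM mulVf ?gt_eqF// powRr1// ltW.
  pose u k y : \bar R := if D%:E < F k y then 1 else 0.
  pose v k y : \bar R :=
    if \big[maxe/0]_(l | Q l && (l != k)) F l y <= D%:E then 1 else 0.
  have mu k : nneg_measurable (u k).
    apply: nneg_measurable_if; try exact: nneg_measurable_cst.
    by apply: measurable_fun_lte => //; exact: (mF k).1.
  have mv k : nneg_measurable (v k).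
    apply: nneg_measurable_if; try exact: nneg_measurable_cst.
    apply: measurable_fun_lee => //.
    exact: (nneg_measurable_max _ _ mF).1.
  pose w k y := F k y `^ p * u k y.
  have mw k : nneg_measurable (w k) by exact: nneg_measurableM.
  have wv y : \sum_(k | Q k) w k y * v k y <= M y.
    have [k /and3P[Qk Dk kD]|none] :=
      pickP [pred k | [&& Q k, D%:E < F k y &
        \big[maxe/0]_(l | Q l && (l != k)) F l y <= D%:E]].
      rewrite (bigD1 k)//= big1 ?adde0; last first.
        move=> l /andP[Ql lk]; rewrite /w /u ifF ?mule0 ?mul0e//.
        apply/negbTE; rewrite -leNgt (le_trans _ kD)//.
        by apply: (le_bigmax_cond _ (fun l => F l y)); rewrite Ql.
      by rewrite /w /u /v Dk kD !mule1 FM.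
    rewrite big1 ?(mM.2 y)// => k Qk; have := none k; rewrite /= Qk/= /w /u /v.
    by case: ifP => /= [_ ->|]; rewrite !(mule0, mul0e).
  have av k : Q k -> 2^-1%:E <= average U (v k) x.
    (* Markov's inequality in averaged form: where [v k] vanishes, some [F l] exceeds [D], so M / (2
       r) >= 1, while M / (2 r) has mean 1/2. *)
    move=> Qk; have : 1 <= average U (v k) x + 2^-1%:E.
      have -> : 2^-1%:E = (2 * r)^-1%:E * average U M x.
        by rewrite rE -EFinM invfM -mulrA mulVf ?mulr1// gt_eqF.
      rewrite -averageZ//; last by rewrite lee_fin invr_ge0 ltW.
      rewrite -averageD//; last first.
        by apply: nneg_measurableZ => //; rewrite invr_ge0 ltW.
      rewrite -[leLHS](average_cst X U 1 x); apply: average_le.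
      - exact: nneg_measurable_cst.
      - apply: nneg_measurableD => //.
        by apply: nneg_measurableZ => //; rewrite invr_ge0 ltW.
      move=> y; rewrite /v; case: ifPn => [_|].
        by rewrite leeDl// mule_ge0 ?(mM.2 y)// lee_fin invr_ge0 ltW.
      rewrite add0e => /bigmax_leP H.
      have [l /andP[Ql lk] DFl] : exists2 l, Q l && (l != k) & D%:E < F l y.
        apply: contrapT => none; apply: H; split; first by rewrite lee_fin ltW.
        move=> l Ql; rewrite leNgt; apply/negP => DFl; apply: none.
        by exists l.
      apply: (@le_trans _ _ ((2 * r)^-1%:E * (2 * r)%:E)).
        by rewrite -EFinM mulVf ?gt_eqF.
      rewrite lee_wpmul2l ?lee_fin ?invr_ge0 ?(ltW r20)//.
      apply: le_trans (FM l y Ql); rewrite -Dp -poweR_EFin.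
      by rewrite le_poweR ?lee_fin ?(ltW p0) ?(ltW D0)// ltW.
    rewrite -leeBlDr// -EFinB; apply: le_trans; rewrite lee_fin; lra.
  have wM k : Q k -> average U (w k) x <= 2%:E * average U (fun y => w k y * v k y) x.
    move=> Qk.
    have wW : depends_on (W k) (w k).
      by move=> y z yz; rewrite /w /u (@FW k _ _ yz).
    have vW : depends_on (W' k) (v k).
      move=> y z yz; rewrite /v.
      by under eq_bigr => l Ql do rewrite (FW' Ql yz).
    rewrite (average_mul indepX x (mw k) (mv k) wW vW (disjW' Qk)).
    rewrite muleCA -[leLHS]mule1 lee_wpmul2l//.
      by apply: average_ge0; exact: (mw k).2.
    apply: (@le_trans _ _ (2%:E * 2^-1%:E)); first by rewrite -EFinM divff.
    by rewrite lee_wpmul2l ?lee_fin ?av.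
  have wsum : \sum_(k | Q k) average U (w k) x <= (2 * r)%:E.
    rewrite EFinM -rE.
    apply: (le_trans (lee_sum _ (fun k Qk => wM k Qk))).
    rewrite -ge0_sume_distrr; last first.
      by move=> k _; apply: average_ge0 => y; exact: (nneg_measurableM (mw k) (mv k)).2.
    rewrite -average_sum; last by move=> k; exact: nneg_measurableM.
    rewrite lee_wpmul2l ?lee_fin//; apply: average_le => //.
    by apply: nneg_measurable_sum => k; exact: nneg_measurableM.
  have Fw : \sum_(k | Q k) average U (fun y => F k y `^ p) x <=
      (2 * r)%:E + (D `^ (p - 1))%:E * A.
    apply: (@le_trans _ _ (\sum_(k | Q k)
       (average U (w k) x + (D `^ (p - 1))%:E * average U (F k) x))).
      apply: lee_sum => k Qk.
      rewrite -averageZ ?lee_fin ?powR_ge0// -averageD//; last first.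
        by apply: nneg_measurableZ => //; exact: powR_ge0.
      apply: average_le => //.
        by apply: nneg_measurableD => //; apply: nneg_measurableZ => //; exact: powR_ge0.
      move=> y; rewrite /w /u; case: ifPn => [_|].
        by rewrite mule1 leeDl// mule_ge0// lee_fin powR_ge0.
      rewrite -leNgt => FD; rewrite mule0 add0e -mule_poweRB1// muleC.
      rewrite lee_wpmul2r// -poweR_EFin le_poweR// subr_ge0.
      exact: ltW.
    rewrite big_split/= -ge0_sume_distrr ?leeD//.
    by move=> k _; exact: average_ge0.
  have r20' := ltW r20; have a0' := ltW a0; have ap0' := ltW ap0.
  apply: (le_trans (lee_wpmul2l _ Fw)); first by rewrite lee_fin.
  (* Regroup a^p D^(p-1) A as a times A (a D)^(p-1) and apply the crude Young inequality. The factor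
     [a] left outside is the origin of 4 a in the bound. *)
  have aDA : (a `^ p)%:E * ((D `^ (p - 1))%:E * A) <=
      a%:E * (A `^ p + (a `^ p * (2 * r))%:E).
    have -> : (a `^ p)%:E = a%:E * (a `^ (p - 1))%:E by rewrite mule_poweRB1.
    rewrite -!muleA lee_wpmul2l ?lee_fin// muleA -EFinM -powRM ?(ltW D0)// muleC.
    rewrite -Dp -powRM ?(ltW D0)//.
    by apply: (@mule_poweRB1_le _ A (a * D)%:E); rewrite // lee_fin mulr_ge0 ?(ltW D0).
  rewrite ge0_muleDr ?mule_ge0 ?lee_fin ?powR_ge0//.
  apply: (le_trans (leeD2l _ aDA)).
  rewrite !ge0_muleDr ?mule_ge0 ?poweR_ge0 ?lee_fin ?mulr_ge0 ?(ltW r0)//.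
  rewrite addeCA addeC leeD//; last first.
    rewrite lee_wpmul2r ?poweR_ge0// lee_fin; lra.
  rewrite -!EFinM -EFinD lee_fin.
  have ar : (0 <= a `^ p * r)%R by rewrite mulr_ge0 ?(ltW r0).
  nra.
- rewrite big1 ?mule0// => k Qk; apply/eqP; rewrite eq_le.
  rewrite average_ge0 ?andbT; last by move=> y; exact: poweR_ge0.
  by rewrite -m_eq0; apply: average_le => // y; exact: FM.
Qed.

End independent_sums.

(** * Sums and maxima over multi-indices *)

Section multi_indices.
Context {m n : nat}.
Implicit Types (A B J : {set 'I_m}) (i k l : multi_index m n).

Definition agree A k i : bool := [forall j in ~: A, k j == i j].

Lemma agreeP A k i : reflect (forall j, j \notin A -> k j = i j) (agree A k i).
Proof.
apply: (iffP forallP) => [ki j jA|ki j].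
  by have /implyP := ki j; rewrite inE => /(_ jA) /eqP.
by apply/implyP; rewrite inE => /ki /eqP.
Qed.

Lemma agree_refl A i : agree A i i.
Proof. by apply/agreeP. Qed.

Definition splice A l i : multi_index m n := [ffun j => if j \in A then l j else i j].

(** The index halfway from [i] to [l] is forced, so an iterated sum over disjoint sets of places
    meets each [l] exactly once. *)
Lemma agree_splice A B k l i : [disjoint A & B]%B -> agree (A :|: B) l i ->
  agree A k i && agree B l k = (k == splice A l i).
Proof.
move=> dAB /agreeP li; apply/andP/eqP => [[/agreeP ki /agreeP lk]|->].
  apply/ffunP => j; rewrite ffunE; case: ifPn => jA; last exact: ki.
  by rewrite lk// (disjointFr dAB jA).
split; apply/agreeP => j jA; rewrite ffunE; first by rewrite (negbTE jA).
by case: ifPn => // jA'; rewrite li// inE negb_or jA'.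
Qed.

Lemma agree_trans A B k l i : agree A k i -> agree B l k -> agree (A :|: B) l i.
Proof.
move=> /agreeP ki /agreeP lk; apply/agreeP => j.
by rewrite inE negb_or => /andP[jA jB]; rewrite lk// ki.
Qed.

Lemma agree0 k i : agree finset.set0 k i = (k == i).
Proof.
apply/agreeP/eqP => [ki|-> //]; apply/ffunP => j; apply: ki.
by rewrite inE.
Qed.

Lemma agreeT k i : agree [set: 'I_m]%SET k i.
Proof. by apply/agreeP => j; rewrite inE. Qed.

Context {R : realType}.
Local Open Scope ereal_scope.
Implicit Types F G : multi_index m n -> \bar R.

Lemma sum_over_comp A B F i : [disjoint A & B]%B ->
  sum_over A (sum_over B F) i = sum_over (A :|: B) F i.
Proof.
move=> dAB; rewrite /sum_over (exchange_big_dep (fun l => agree (A :|: B) l i))/=.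
  apply: eq_bigr => l li; rewrite (eq_bigl (pred1 (splice A l i))) ?big_pred1_eq//.
  by move=> k; exact: agree_splice.
by move=> k l; exact: agree_trans.
Qed.

(** With neutral element 0 the maximum is nonnegative and measurable by construction; on nonnegative
    families it agrees with [max_over], see [max_overE]. *)
Definition max0_over A F i := \big[maxe/0]_(k : multi_index m n | agree A k i) F k.

Lemma max0_over_ge A F k i : agree A k i -> F k <= max0_over A F i.
Proof. by move=> ki; exact: (le_bigmax_cond _ F). Qed.

Lemma max0_over_ge0 A F i : 0 <= max0_over A F i.
Proof. exact: bigmax_ge_id. Qed.

Lemma max0_over_le A F i x : 0 <= x -> (forall k, agree A k i -> F k <= x) ->
  max0_over A F i <= x.
Proof. by move=> x0 Fx; exact: bigmax_le. Qed.

Lemma max0_over_comp A B F i : [disjoint A & B]%B ->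
  max0_over A (max0_over B F) i = max0_over (A :|: B) F i.
Proof.
move=> dAB; apply/eqP; rewrite eq_le; apply/andP; split.
  apply: max0_over_le => [|k ki]; first exact: max0_over_ge0.
  apply: max0_over_le => [|l lk]; first exact: max0_over_ge0.
  by apply: max0_over_ge; exact: agree_trans lk.
apply: max0_over_le => [|l li]; first exact: max0_over_ge0.
have := agree_splice (splice A l i) dAB li; rewrite eqxx => /andP[ki lk].
by apply: le_trans (max0_over_ge _ ki); exact: max0_over_ge.
Qed.

Lemma max_overE A F i : (forall k, 0 <= F k) -> max_over A F i = max0_over A F i.
Proof.
move=> F0; apply/eqP; rewrite eq_le; apply/andP; split.
  by apply: bigmax_le; [exact: leNye|move=> k; exact: max0_over_ge].
apply: max0_over_le => [|k ki].
  apply: le_trans (F0 i) _; apply: (le_bigmax_cond _ F); exact: agree_refl.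
exact: (le_bigmax_cond _ F).
Qed.

Lemma max0_over_le_sum A F i : (forall k, 0 <= F k) ->
  max0_over A F i <= sum_over A F i.
Proof.
move=> F0; apply: max0_over_le => [|k ki]; first exact: sume_ge0.
by rewrite /sum_over (bigD1 k)//= leeDl// sume_ge0.
Qed.

Lemma max0_over_poweR A F i (r : R) : (0 < r)%R -> (forall k, 0 <= F k) ->
  max0_over A (fun k => F k `^ r) i = max0_over A F i `^ r.
Proof.
move=> r0 F0; apply/eqP; rewrite eq_le; apply/andP; split.
  apply: max0_over_le => [|k ki]; first exact: poweR_ge0.
  by rewrite le_poweR ?(ltW r0)//; exact: max0_over_ge.
set z := max0_over A (fun k => F k `^ r) i.
have zE : z = (z `^ r^-1) `^ r.
  by rewrite -poweRrM mulVf ?gt_eqF// poweRe1// max0_over_ge0.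
rewrite zE le_poweR ?(ltW r0) ?max0_over_ge0//.
apply: max0_over_le => [|k ki]; first exact: poweR_ge0.
rewrite -[F k]poweRe1// -[X in _ `^ X](@mulfV _ r) ?gt_eqF// poweRrM.
rewrite le_poweR ?invr_ge0 ?(ltW r0) ?poweR_ge0//.
exact: (max0_over_ge (fun k => F k `^ r)).
Qed.

Lemma sum_over0 F i : sum_over finset.set0 F i = F i.
Proof.
rewrite /sum_over (eq_bigl (pred1 i)) ?big_pred1_eq// => k.
exact: agree0.
Qed.

Lemma max0_over0 F i : 0 <= F i -> max0_over finset.set0 F i = F i.
Proof.
move=> F0; apply/eqP; rewrite eq_le max0_over_ge ?agree_refl// andbT.
by apply: max0_over_le => // k; rewrite agree0 => /eqP ->.
Qed.

Lemma sum_over_le A F G i : (forall k, F k <= G k) ->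
  sum_over A F i <= sum_over A G i.
Proof. by move=> FG; exact: lee_sum. Qed.

End multi_indices.

(** * Iteration over the coordinates *)

Section kernels.
Context {d d' : measure_display} {T : measurableType d} {S : measurableType d'}.
Context {R : realType} (P : probability T R) {m n : nat}.
Local Notation I := ('I_m * 'I_n)%type.
Variable X : I -> {RV P >-> S}.
Hypothesis indepX : mutually_independent P (fun i => X i : T -> S).
Variable g : multi_index m n -> config I S -> \bar R.
Hypothesis mg : forall l, nneg_measurable (g l).
Hypothesis g_dep : forall l : multi_index m n,
  depends_on [set ji : I | ji.2 == l ji.1]%SET (g l).
Variables (i0 : multi_index m n) (x0 : config I S) (p : R).
Hypothesis p1 : (1 < p)%R.
Local Open Scope ereal_scope.
Implicit Types (A B J L V : {set 'I_m}) (i k l : multi_index m n) (x y : config I S).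

Definition slab V : {set I} := [set ji : I | ji.1 \in V]%SET.

Definition EE V : (config I S -> \bar R) -> config I S -> \bar R :=
  average X (slab V).

(** Summed places [A] and averaged places [V] vary separately; [A] = [V] = [~: J] gives the inner
    sum of the mixed moment of [J]. *)
Definition partial_sum A V i x := sum_over A (fun l => EE V (g l) x) i.

(** All that a term with i_j = [b] can read when place j is not summed. Slices for different [b]
    meet only outside block j, so such terms are independent once the other blocks are frozen. *)
Definition slice (j : 'I_m) (b : 'I_n) : {set I} :=
  [set ji : I | (ji.1 == j) ==> (ji.2 == b)]%SET.

Lemma slab_disjoint V A : [disjoint V & A]%B -> [disjoint slab V & slab A]%B.
Proof.
move=> dVA; rewrite -setI_eq0; apply/eqP/setP => ji; rewrite !inE.
by apply/negP => /andP[jV]; rewrite (disjointFr dVA jV).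
Qed.

Lemma slabU V A : slab (V :|: A) = slab V :|: slab A.
Proof. by apply/setP => ji; rewrite !inE. Qed.

Lemma EE_EE V A (F : config I S -> \bar R) x : nneg_measurable F ->
  [disjoint V & A]%B -> EE V (EE A F) x = EE (V :|: A) F x.
Proof.
by move=> mF dVA; rewrite /EE (average_average indepX)// ?slabU// slab_disjoint.
Qed.

Lemma nneg_measurable_EE V F : nneg_measurable F -> nneg_measurable (EE V F).
Proof. exact: nneg_measurable_average. Qed.

Lemma nneg_measurable_sum_over A (F : multi_index m n -> config I S -> \bar R) i :
  (forall l, nneg_measurable (F l)) ->
  nneg_measurable (fun x => sum_over A (fun l => F l x) i).
Proof. by move=> mF; exact: nneg_measurable_sum. Qed.

Lemma nneg_measurable_partial_sum A V i : nneg_measurable (partial_sum A V i).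
Proof. by apply: nneg_measurable_sum_over => l; exact: nneg_measurable_EE. Qed.

Lemma EE_sum_over V A (F : multi_index m n -> config I S -> \bar R) i x :
  (forall l, nneg_measurable (F l)) ->
  EE V (fun y => sum_over A (fun l => F l y) i) x =
  sum_over A (fun l => EE V (F l) x) i.
Proof. by move=> mF; exact: average_sum. Qed.

Lemma EE_partial_sum V A B i x : [disjoint V & A]%B ->
  EE V (partial_sum B A i) x = partial_sum B (V :|: A) i x.
Proof.
move=> dVA; rewrite /partial_sum EE_sum_over; last by move=> l; exact: nneg_measurable_EE.
by apply: eq_bigr => l _; rewrite EE_EE.
Qed.

Lemma partial_sum_ge0 A V i x : 0 <= partial_sum A V i x.
Proof. exact: (nneg_measurable_partial_sum A V i).2. Qed.

Lemma depends_on_partial_sum A V (j : 'I_m) i : j \notin A ->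
  depends_on (slice j (i j)) (partial_sum A V i).
Proof.
move=> jA x y xy; apply: eq_bigr => l /agreeP li.
apply: (@depends_on_average _ _ _ _ _ P _ X (slab V) _ _ (@g_dep l)) => ji.
rewrite !inE => /andP[_ /eqP jil]; apply: xy; rewrite inE.
by apply/implyP => /eqP ji1; rewrite jil ji1 li.
Qed.

Lemma slice_disjoint (j : 'I_m) k l i : agree [set j]%SET k i ->
  agree [set j]%SET l i -> k != l ->
  [disjoint slab [set j]%SET :&: slice j (k j) & slice j (l j)]%B.
Proof.
move=> /agreeP ki /agreeP li kl; rewrite -setI_eq0; apply/eqP/setP => ji.
rewrite !inE; case: eqP => //= _; apply/andP => -[/eqP e /eqP klj].
case/eqP: kl; apply/ffunP => j'; have [->|jj'] := eqVneq j' j; first by rewrite -e.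
by rewrite ki ?inE// li ?inE.
Qed.

(* Interpolates between E (sum h)^p (B empty, L everything) and the sums
   sum_(i_B) E_B (sum_(i_B^c) E_B^c h)^p (L empty). *)
Definition split_moment B L : \bar R :=
  EE (B :|: L) (fun x =>
    sum_over B (fun i => partial_sum (~: B) (~: (B :|: L)) i x `^ p) i0) x0.

(** Freeze all blocks but j and apply (A) to the sum over i_j. In the p-th power of the sum of
    means, the average over block j moves inside the power; in the sum of p-th moments, the sum over
    i_j moves outside, so j joins [B] at the price p^p. *)
Lemma split_moment_step B L (j : 'I_m) : j \in L -> [disjoint B & L]%B ->
  split_moment B L <= ((4 * expR 1) `^ p)%:E *
    (split_moment B (L :\ j) +
     (p `^ p)%:E * split_moment (j |: B) (L :\ j)).
Proof.
move=> jL dBL; set C := ((4 * expR 1) `^ p)%R.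
have jB : j \notin B by rewrite (disjointFl dBL jL).
have BLE : B :|: L = (B :|: L :\ j) :|: [set j]%SET.
  apply/setP => a; rewrite !inE; case: (eqVneq a j) => [->|_].
    by rewrite jL !orbT.
  by rewrite orbF.
have jBLE : (j |: B) :|: (L :\ j) = B :|: L.
  apply/setP => a; rewrite !inE; case: (eqVneq a j) => [->|_]//=.
  by rewrite jL orbT.
have nBLE : ~: (B :|: L :\ j) = [set j]%SET :|: ~: (B :|: L).
  apply/setP => a; rewrite !inE; case: (eqVneq a j) => [->|_]//=.
  by rewrite (negbTE jB).
have nBE : ~: B = [set j]%SET :|: ~: (j |: B).
  by apply/setP => a; rewrite !inE; case: (eqVneq a j) => [->|_].
have dB : [disjoint [set j]%SET & ~: (j |: B)]%B.
  by rewrite disjoints1 !inE eqxx.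
have dBj : [disjoint B & [set j]%SET]%B by rewrite disjoint_sym disjoints1.
have djV : [disjoint [set j]%SET & ~: (B :|: L)]%B.
  by rewrite disjoints1 !inE jL orbT.
have d1 : [disjoint B :|: L :\ j & [set j]%SET]%B.
  by rewrite disjoint_sym disjoints1 !inE eqxx (negbTE jB).
set V := ~: (B :|: L) in nBLE djV *.
pose F l := partial_sum (~: (j |: B)) V l.
have mF l : nneg_measurable (F l) by exact: nneg_measurable_partial_sum.
have mps i r : nneg_measurable (fun x => partial_sum (~: B) V i x `^ r).
  by apply: nneg_measurable_powR; exact: nneg_measurable_partial_sum.
have psF i x : partial_sum (~: B) V i x = sum_over [set j]%SET (F^~ x) i.
  by rewrite /F /partial_sum sum_over_comp// -nBE.
have C0 : (0 <= C)%R by exact: powR_ge0.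
have q0 : (0 <= p `^ p)%R by exact: powR_ge0.
have mFp l : nneg_measurable (fun y => F l y `^ p) by exact: nneg_measurable_powR.
have step i x : EE [set j]%SET (fun y => partial_sum (~: B) V i y `^ p) x <=
    C%:E * (partial_sum (~: B) (~: (B :|: L :\ j)) i x `^ p +
      (p `^ p)%:E * sum_over [set j]%SET (fun l => EE [set j]%SET (fun y => F l y `^ p) x) i).
  under [X in EE _ X _]eq_fun do rewrite psF.
  have -> : partial_sum (~: B) (~: (B :|: L :\ j)) i x =
      sum_over [set j]%SET (fun l => EE [set j]%SET (F l) x) i.
    rewrite -EE_sum_over// nBLE -EE_partial_sum//.
    by congr (EE _ _ x); apply/funext => y; exact: psF.
  apply: (average_sum_poweR indepX (Q := fun l => agree [set j]%SET l i)
    (W := fun l => slice j (l j))) => //.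
  - by move=> k l ki li; exact: slice_disjoint li.
  - by move=> l; apply: depends_on_partial_sum; rewrite !inE eqxx.
have mS : nneg_measurable (fun x =>
    sum_over B (fun i => partial_sum (~: B) V i x `^ p) i0).
  exact: nneg_measurable_sum_over.
rewrite /split_moment jBLE -/V BLE -EE_EE//.
have m1 : nneg_measurable (fun x =>
    sum_over B (fun i => partial_sum (~: B) (~: (B :|: L :\ j)) i x `^ p) i0).
  apply: nneg_measurable_sum_over => l; apply: nneg_measurable_powR.
  exact: nneg_measurable_partial_sum.
have m2 : nneg_measurable (fun x => sum_over (j |: B)
    (fun l => EE [set j]%SET (fun y => F l y `^ p) x) i0).
  by apply: nneg_measurable_sum_over => l; exact: nneg_measurable_EE.
apply: (@le_trans _ _ (EE (B :|: L :\ j) (fun x => C%:E *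
    (sum_over B (fun i => partial_sum (~: B) (~: (B :|: L :\ j)) i x `^ p) i0 +
     (p `^ p)%:E * sum_over (j |: B)
       (fun l => EE [set j]%SET (fun y => F l y `^ p) x) i0)) x0)).
  apply: average_le.
  - exact: nneg_measurable_EE.
  - by apply: nneg_measurableZ => //; apply: nneg_measurableD => //; exact: nneg_measurableZ.
  move=> x; rewrite EE_sum_over//.
  apply: (le_trans (sum_over_le _ _ (step^~ x))).
  rewrite /sum_over -ge0_sume_distrr; last first.
    move=> i _; rewrite adde_ge0 ?poweR_ge0// mule_ge0 ?lee_fin//.
    by apply: sume_ge0 => l _; exact: (nneg_measurable_EE _ (mFp l)).2.
  rewrite lee_wpmul2l ?lee_fin// big_split/= leeD2l// -ge0_sume_distrr; last first.
    move=> i _; apply: sume_ge0 => l _; exact: (nneg_measurable_EE _ (mFp l)).2.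
  rewrite lee_wpmul2l ?lee_fin//.
  by rewrite [leLHS](sum_over_comp _ _ dBj) finset.setUC.
rewrite /EE averageZ ?lee_fin//; last first.
  by apply: nneg_measurableD => //; exact: nneg_measurableZ.
rewrite lee_wpmul2l ?lee_fin// averageD//; last exact: nneg_measurableZ.
rewrite averageZ ?lee_fin// leeD2l// lee_wpmul2l ?lee_fin//.
rewrite -/(EE _) [leLHS](_ : _ = EE (B :|: L :\ j) (EE [set j]%SET
    (fun x => sum_over (j |: B) (fun l => F l x `^ p) i0)) x0); last first.
  by congr (EE _ _ x0); apply/funext => x; rewrite EE_sum_over.
by rewrite EE_EE//; exact: nneg_measurable_sum_over.
Qed.

(* Interpolates between sum_(i_J) (D empty) and max_(i_J) (D = J). *)
Definition max_moment J (D : {set 'I_m}) :=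
  EE J (fun x => sum_over (J :\: D)
    (fun i => max0_over D (fun l => partial_sum (~: J) (~: J) l x `^ p) i) i0) x0.

(** The p-th moment of the whole sum after averaging the places outside [L]: the form of the error
    terms when a sum becomes a maximum. *)
Definition full_moment L :=
  EE L (fun x => partial_sum [set: 'I_m]%SET (~: L) i0 x `^ p) x0.

Lemma nneg_measurable_max0_over A (F : multi_index m n -> config I S -> \bar R) i :
  (forall l, nneg_measurable (F l)) ->
  nneg_measurable (fun x => max0_over A (fun l => F l x) i).
Proof. by move=> mF; exact: nneg_measurable_max. Qed.

(** Freeze all blocks but j and apply (B) to the sum over i_j of the maxima over i_D. The maxima
    merge into one over [j |: D]; the p-th power of the sum of means is the error. *)
Lemma max_moment_step J (D : {set 'I_m}) (j : 'I_m) (a : R) :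
  j \in J -> j \notin D -> D \subset J -> (1 <= a)%R ->
  (a `^ p)%:E * max_moment J D <= (4 * a)%:E *
    ((a `^ p)%:E * max_moment J (j |: D) + full_moment (J :\ j)).
Proof.
move=> jJ jD DJ a1; have p0 : (0 < p)%R by rewrite (lt_trans _ p1).
have a0 : (0 <= a)%R by rewrite (le_trans _ a1).
have JE : J = (J :\ j) :|: [set j]%SET.
  apply/setP => b; rewrite !inE; case: (eqVneq b j) => [->|_]/=; first by rewrite jJ.
  by rewrite orbF.
have d1 : [disjoint J :\ j & [set j]%SET]%B.
  by rewrite disjoint_sym disjoints1 !inE eqxx.
have JDE : J :\: D = (J :\: (j |: D)) :|: [set j]%SET.
  apply/setP => b; rewrite !inE; case: (eqVneq b j) => [->|_]/=; first by rewrite jJ jD.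
  by rewrite orbF.
have d2 : [disjoint J :\: (j |: D) & [set j]%SET]%B.
  by rewrite disjoint_sym disjoints1 !inE eqxx.
have djD : [disjoint [set j]%SET & D]%B by rewrite disjoints1.
have d3 : [disjoint J :\: D & D]%B.
  by rewrite -setI_eq0; apply/eqP/setP => b; rewrite !inE; case: (b \in D); rewrite ?andbF.
have JD : J :\: D :|: D = J.
  apply/setP => b; rewrite !inE; case: (boolP (b \in D)) => [/(fintype.subsetP DJ) ->|_]//.
  by rewrite orbF.
have dJj : [disjoint J & ~: J]%B.
  by rewrite -setI_eq0; apply/eqP/setP => b; rewrite !inE andbN.
have djJ : [disjoint [set j]%SET & ~: J]%B by rewrite disjoints1 !inE negbK.
have nJ : ~: (J :\ j) = [set j]%SET :|: ~: J.
  by apply/setP => b; rewrite !inE; case: (eqVneq b j) => [->|_].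
have EEJ F x : nneg_measurable F -> EE J F x = EE (J :\ j) (EE [set j]%SET F) x.
  by move=> mF; rewrite EE_EE// -JE.
pose f l := partial_sum (~: J) (~: J) l.
have f0 l x : 0 <= f l x by exact: partial_sum_ge0.
have mf l : nneg_measurable (f l) by exact: nneg_measurable_partial_sum.
pose xi l x := max0_over D (f^~ x) l.
have xi0 l x : 0 <= xi l x by exact: max0_over_ge0.
have mxi l : nneg_measurable (xi l) by exact: nneg_measurable_max0_over.
have mxip l : nneg_measurable (fun x => xi l x `^ p) by exact: nneg_measurable_powR.
have mfp l : nneg_measurable (fun x => f l x `^ p) by exact: nneg_measurable_powR.
have xiE l x : max0_over D (fun l => f l x `^ p) l = xi l x `^ p.
  exact: max0_over_poweR.
have q0 : (0 <= a `^ p)%R by exact: powR_ge0.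
set B := J :\: (j |: D) in JDE d2 *.
have step i x : (a `^ p)%:E * sum_over [set j]%SET
      (fun l => EE [set j]%SET (fun y => xi l y `^ p) x) i <=
    (4 * a)%:E * ((a `^ p)%:E *
        EE [set j]%SET (fun y => max0_over (j |: D) (fun l => f l y `^ p) i) x +
      (sum_over [set j]%SET (fun l => EE [set j]%SET (xi l) x) i) `^ p).
  rewrite (_ : (fun y => max0_over (j |: D) _ i) = fun y =>
      max0_over [set j]%SET (fun l => xi l y `^ p) i); last first.
    apply/funext => y; rewrite -max0_over_comp//; congr max0_over.
    by apply/funext => l; exact: xiE.
  apply: (sum_average_poweR_le indepX (Q := fun l => agree [set j]%SET l i)
    (W := fun l => slice j (l j))) => //.
  - by move=> k l ki li; exact: slice_disjoint li.
  - move=> l x' y' xy; apply: eq_bigr => k /agreeP kl.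
    have jJ' : j \notin ~: J by rewrite inE negbK.
    by apply: (depends_on_partial_sum (~: J) (i := k) jJ'); rewrite kl.
(* The remaining outer sum enters the power by superadditivity, and the maximum over [D] is at most
   the sum over [D]. All places of [J] are then summed inside, with j and [~: J] averaged. *)
have xi_sum i x : sum_over B (fun i =>
      (sum_over [set j]%SET (fun l => EE [set j]%SET (xi l) x) i) `^ p) i <=
    partial_sum [set: 'I_m]%SET (~: (J :\ j)) i x `^ p.
  have s0 k : 0 <= sum_over [set j]%SET (fun l => EE [set j]%SET (xi l) x) k.
    by apply: sume_ge0 => l _; exact: (nneg_measurable_EE _ (mxi l)).2.
  apply: le_trans (sum_poweR_le _ _ p1 s0) _.
  rewrite le_poweR ?(ltW p0)//; first exact: sume_ge0.
  rewrite [leLHS](sum_over_comp _ _ d2) -JDE.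
  apply: (@le_trans _ _ (sum_over (J :\: D) (fun l => sum_over D
      (fun k => EE [set j]%SET (f k) x) l) i)).
    apply: sum_over_le => l; rewrite -EE_sum_over//.
    apply: average_le => //; first exact: nneg_measurable_sum_over.
    by move=> y; exact: max0_over_le_sum.
  rewrite sum_over_comp// JD nJ.
  under [X in sum_over J X _]eq_fun do rewrite /f EE_partial_sum//.
  by rewrite /partial_sum sum_over_comp// finset.setUCr.
rewrite /max_moment /full_moment -/B -/(f _).
have mmax i : nneg_measurable (fun y => max0_over (j |: D) (fun l => f l y `^ p) i).
  by apply: nneg_measurable_max0_over => l; exact: nneg_measurable_powR.
have mfull : nneg_measurable (fun x => partial_sum [set: 'I_m]%SET (~: (J :\ j)) i0 x `^ p).
  by apply: nneg_measurable_powR; exact: nneg_measurable_partial_sum.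
rewrite [X in _ * X <= _](_ : _ = EE (J :\ j) (fun x => sum_over B (fun i =>
    sum_over [set j]%SET (fun l => EE [set j]%SET (fun y => xi l y `^ p) x) i) i0) x0); last first.
  rewrite EEJ; last first.
    by apply: nneg_measurable_sum_over => l; apply: nneg_measurable_max0_over => k; exact: mfp.
  congr (EE _ _ x0); apply/funext => x; rewrite EE_sum_over; last first.
    by move=> l; apply: nneg_measurable_max0_over => k; exact: mfp.
  rewrite sum_over_comp// -JDE; apply: eq_bigr => l _; congr (EE _ _ x).
  by apply/funext => y; exact: xiE.
rewrite [X in (a `^ p)%:E * X + _](_ : _ = EE (J :\ j) (fun x => sum_over B (fun i =>
   EE [set j]%SET (fun y => max0_over (j |: D) (fun l => f l y `^ p) i) x) i0) x0); last first.
  rewrite EEJ; last exact: nneg_measurable_sum_over.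
  by congr (EE _ _ x0); apply/funext => x; rewrite EE_sum_over.
have m1 : nneg_measurable (fun x => sum_over B (fun i =>
    sum_over [set j]%SET (fun l => EE [set j]%SET (fun y => xi l y `^ p) x) i) i0).
  by apply: nneg_measurable_sum_over => i; apply: nneg_measurable_sum_over => l; exact: nneg_measurable_EE.
have m2 : nneg_measurable (fun x => sum_over B (fun i =>
   EE [set j]%SET (fun y => max0_over (j |: D) (fun l => f l y `^ p) i) x) i0).
  by apply: nneg_measurable_sum_over => i; exact: nneg_measurable_EE.
have a40 : (0 <= 4 * a)%R by rewrite mulr_ge0.
rewrite -!averageZ ?lee_fin//.
rewrite -averageD//; last exact: nneg_measurableZ.
rewrite -averageZ ?lee_fin//; last first.
  by apply: nneg_measurableD => //; exact: nneg_measurableZ.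
apply: average_le.
- exact: nneg_measurableZ.
- by apply: nneg_measurableZ => //; apply: nneg_measurableD => //; exact: nneg_measurableZ.
move=> x; rewrite /sum_over ge0_sume_distrr; last first.
  move=> i _; apply: sume_ge0 => l _; exact: (nneg_measurable_EE _ (mxip l)).2.
apply: (le_trans (sum_over_le _ _ (step^~ x))).
rewrite /sum_over -ge0_sume_distrr; last first.
  move=> i _; rewrite adde_ge0 ?poweR_ge0// mule_ge0 ?lee_fin//.
  exact: (nneg_measurable_EE _ (mmax i)).2.
rewrite lee_wpmul2l ?lee_fin// big_split/=.
rewrite -ge0_sume_distrr; last first.
  by move=> i _; exact: (nneg_measurable_EE _ (mmax i)).2.
by rewrite leeD2l//; exact: xi_sum.
Qed.

Lemma split_moment0 J : split_moment J finset.set0 = max_moment J finset.set0.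
Proof.
rewrite /split_moment /max_moment finset.setU0 finset.setD0.
congr (EE J _ x0); apply/funext => x; apply: eq_bigr => i _.
by rewrite max0_over0// poweR_ge0.
Qed.

Lemma full_momentE L : full_moment L = split_moment finset.set0 L.
Proof.
rewrite /full_moment /split_moment finset.set0U finset.setC0.
by congr (EE L _ x0); apply/funext => x; rewrite sum_over0.
Qed.

Lemma EE_ge0 V F x : (forall y, 0 <= F y) -> 0 <= EE V F x.
Proof. exact: average_ge0. Qed.

Lemma split_moment_ge0 B L : 0 <= split_moment B L.
Proof. by apply: EE_ge0 => x; apply: sume_ge0 => i _; exact: poweR_ge0. Qed.

Lemma max_moment_ge0 J (D : {set 'I_m}) : 0 <= max_moment J D.
Proof. by apply: EE_ge0 => x; apply: sume_ge0 => i _; exact: max0_over_ge0. Qed.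

Lemma full_moment_ge0 L : 0 <= full_moment L.
Proof. by rewrite full_momentE split_moment_ge0. Qed.

(** * Iteration of the one-coordinate steps *)

Let q : R := (p `^ p)%R.

Let q1 : (1 <= q)%R.
Proof.
have p0 : (0 <= p)%R by rewrite (le_trans _ (ltW p1)).
by rewrite -(powRr0 p) ler_powR// ltW.
Qed.

Let qJ_ge0 J : 0 <= (q ^+ #|J|)%:E.
Proof. by rewrite lee_fin exprn_ge0// (le_trans _ q1). Qed.

(** Each j in [L] is either averaged inside or added to [B], so every J between [B] and [B :|: L] is
    reached exactly once, at a cost (4 e)^p per coordinate. The weight q^|B| accounts for the factor
    p^p of each added coordinate. *)
Lemma split_moment_le B L : [disjoint B & L]%B ->
  (q ^+ #|B|)%:E * split_moment B L <= (((4 * expR 1) `^ p) ^+ #|L|)%:E *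
    \sum_(J : {set 'I_m} | (B \subset J) && (J \subset B :|: L))
      (q ^+ #|J|)%:E * max_moment J finset.set0.
Proof.
set c := ((4 * expR 1) `^ p)%R; have c0 : (0 <= c)%R by exact: powR_ge0.
have [N] := ubnP #|L|; elim: N B L => // N IHN B L; rewrite ltnS => LN dBL.
have [->|/set0Pn[j jL]] := eqVneq L finset.set0.
  rewrite cards0 expr0 mul1e finset.setU0 (eq_bigl (pred1 B)).
    by rewrite big_pred1_eq split_moment0.
  by move=> J; rewrite /= finset.eqEsubset andbC.
have jB : j \notin B by rewrite (disjointFl dBL jL).
have L'N : (#|L :\ j| < N)%N by rewrite (leq_trans _ LN)// (cardsD1 j L) jL.
have dB' : [disjoint B & L :\ j]%B by apply: disjointWr dBL; exact: subD1set.
have djB' : [disjoint j |: B & L :\ j]%B.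
  rewrite -setI_eq0; apply/eqP/setP => a; rewrite !inE.
  case: (eqVneq a j) => //= _; apply/negP => /andP[aB].
  by rewrite (disjointFr dBL aB).
have q0 : (0 <= q)%R by rewrite (le_trans _ q1).
apply: (le_trans (lee_wpmul2l (qJ_ge0 B) (split_moment_step jL dBL))).
rewrite (cardsD1 j L) jL add1n exprS EFinM muleCA -muleA.
rewrite lee_wpmul2l ?lee_fin// ge0_muleDr ?split_moment_ge0//; last first.
  by rewrite mule_ge0 ?split_moment_ge0// lee_fin.
rewrite muleA -EFinM -exprSr -/q.
have -> : (#|B|.+1 = #|j |: B|)%N by rewrite cardsU1 jB.
apply: (le_trans (leeD (IHN _ _ L'N dB') (IHN _ _ L'N djB'))).
rewrite -ge0_muleDr; last 2 first.
- by apply: sume_ge0 => J _; rewrite mule_ge0 ?max_moment_ge0.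
- by apply: sume_ge0 => J _; rewrite mule_ge0 ?max_moment_ge0.
rewrite lee_wpmul2l ?lee_fin ?exprn_ge0// addeC [leRHS](bigID (fun J => j \in J))/=.
rewrite le_eqVlt; apply/orP; left; apply/eqP; congr (_ + _).
  apply: eq_bigl => J; rewrite finset.subUset finset.sub1set.
  have -> : (j |: B) :|: (L :\ j) = B :|: L.
    apply/setP => a; rewrite !inE; case: (eqVneq a j) => [->|_]//=.
    by rewrite jL orbT.
  by case: (j \in J); case: (B \subset J); case: (J \subset B :|: L).
apply: eq_bigl => J; case: (boolP (j \in J)) => jJ; rewrite ?andbF ?andbT.
  apply/negbTE; rewrite negb_and; apply/orP; right; apply/subsetPn.
  by exists j => //; rewrite !inE eqxx orbF.
congr (_ && _); apply/fintype.subsetP/fintype.subsetP => JB a aJ; have := JB a aJ; rewrite !inE.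
  by move=> /orP[->//|/andP[_ ->]]; rewrite orbT.
by move=> /orP[->//|->]; rewrite andbT (contraNneq _ jJ) ?orbT// => <-.
Qed.

Let expR1_ge1 : (1 <= expR 1 :> R)%R.
Proof. by rewrite -expR0 ler_expR. Qed.

(** Dominates the loss 4 p^|J| of [max_moment_step] by 4 <= 4^p and p <= e^p. *)
Let b : R := ((4 * expR 1 ^+ m) `^ p)%R.

Let b1 : (1 <= b)%R.
Proof.
have h : (1 <= 4 * expR 1 ^+ m :> R)%R.
  have := exprn_ege1 m expR1_ge1; lra.
by rewrite (le_trans h)// le_powR1.
Qed.

(** Iterates [max_moment_step] until [D] = [J]. The 2 in 2 b pays for adding one error term at each
    step: both that error and the induction bound are at most (2 b)^k W, with k the number of places
    still to treat. *)
Lemma max_moment_le J (D : {set 'I_m}) : D \subset J ->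
  (q ^+ #|J|)%:E * max_moment J D <= ((2 * b) ^+ #|J :\: D|)%:E *
    ((q ^+ #|J|)%:E * max_moment J J +
     \sum_(j in J) full_moment (J :\ j)).
Proof.
set W := (q ^+ #|J|)%:E * max_moment J J + _.
have W0 : 0 <= W.
  rewrite adde_ge0 ?mule_ge0 ?max_moment_ge0//.
  by apply: sume_ge0 => j _; exact: full_moment_ge0.
have p0 : (0 <= p)%R by rewrite (le_trans _ (ltW p1)).
have b0 : (0 <= b)%R by rewrite (le_trans _ b1).
have b21 : (1 <= 2 * b)%R by move: b1; lra.
have [N] := ubnP #|J :\: D|; elim: N D => // N IHN D; rewrite ltnS => JDN DJ.
have [JD0|/set0Pn[j]] := eqVneq (J :\: D) finset.set0.
  have -> : D = J by apply/eqP; rewrite finset.eqEsubset DJ -finset.setD_eq0 JD0 eqxx.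
  rewrite finset.setDv cards0 expr0 mul1e leeDl//.
  by apply: sume_ge0 => k _; exact: full_moment_ge0.
rewrite inE => /andP[jD jJ].
have jDE : J :\: (j |: D) = (J :\: D) :\ j.
  by apply/setP => a; rewrite !inE negb_or andbA.
have JDj : #|J :\: D| = #|J :\: (j |: D)|.+1.
  by rewrite jDE (cardsD1 j (J :\: D)) inE jD jJ.
have N' : (#|J :\: (j |: D)| < N)%N by rewrite -JDj.
have DJ' : j |: D \subset J by rewrite finset.subUset finset.sub1set jJ.
have a1 : (1 <= p ^+ #|J|)%R by rewrite exprn_ege1// ltW.
have aq : ((p ^+ #|J|) `^ p = q ^+ #|J|)%R by rewrite powR_exprn.
have := max_moment_step jJ jD DJ a1; rewrite aq => /le_trans; apply.
apply: (@le_trans _ _ (b%:E * ((q ^+ #|J|)%:E * max_moment J (j |: D) + full_moment (J :\ j)))).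
  rewrite lee_wpmul2r//.
    by rewrite adde_ge0 ?full_moment_ge0// mule_ge0 ?max_moment_ge0.
  rewrite lee_fin /b powRM// ler_pM//; first by rewrite exprn_ge0.
    by rewrite le_powR1 ?ler1n.
  rewrite powR_exprn ?expR_ge0//.
  have p2 : (p <= expR 1 `^ p)%R.
    by rewrite /powR gt_eqF ?expR_gt0// expRK mulr1 (le_trans _ (expR_ge1Dx p))// lerDr.
  apply: (@le_trans _ _ ((expR 1 `^ p) ^+ #|J|)%R); first by rewrite lerXn2r ?nnegrE ?powR_ge0.
  rewrite ler_weXn2l//; first by rewrite (le_trans (ltW p1)).
  by rewrite -[X in (_ <= X)%N]card_ord max_card.
rewrite JDj exprS EFinM -muleA.
apply: (@le_trans _ _ (b%:E * (2%:E * (((2 * b) ^+ #|J :\: (j |: D)|)%:E * W)))).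
  rewrite lee_wpmul2l ?lee_fin// mule_natl mule2n leeD ?IHN//.
  apply: (@le_trans _ _ W).
    rewrite /W (bigD1 j)//= addeCA leeDl// adde_ge0 ?mule_ge0 ?max_moment_ge0//.
    by apply: sume_ge0 => k _; exact: full_moment_ge0.
  by rewrite -[leLHS]mul1e lee_wpmul2r// lee_fin exprn_ege1.
have -> : (2 * b)%:E = b%:E * 2%:E by rewrite -EFinM mulrC.
by rewrite -(muleA b%:E).
Qed.

(** The factors come from [split_moment_le], from [max_moment_le], and from counting: besides the
    main term there are at most m errors for each set J. Taking p-th powers dominates the actual
    losses, as 2 <= 2^p and the count is below its p-th power. *)
Definition moment_base : R :=
  ((4 * expR 1) ^+ m * (2 * (4 * expR 1 ^+ m)) ^+ m *
   (1 + #|{set 'I_m}|%:R * m%:R))%R.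

Lemma moment_base_ge1 : (1 <= moment_base)%R.
Proof.
have e1 : (1 <= 4 * expR 1 :> R)%R.
  have := expR1_ge1; lra.
have h : (1 <= 2 * (4 * expR 1 ^+ m) :> R)%R.
  have := exprn_ege1 m expR1_ge1; lra.
rewrite /moment_base !mulr_ege1 ?exprn_ege1//.
by rewrite lerDl mulr_ge0.
Qed.

(** Splitting and passing to maxima produces errors [full_moment (J :\ j)] with [J] inside [L].
    These sets are strictly smaller, so the induction hypothesis costs at most G^|L|, and one
    further factor G pays for the present round. *)
Lemma full_moment_le L : full_moment L <=
  ((moment_base `^ p) ^+ #|L|.+1)%:E *
  \sum_(J : {set 'I_m} | J \subset L) (q ^+ #|J|)%:E * max_moment J J.
Proof.
set G := (moment_base `^ p)%R.
have G1 : (1 <= G)%R by rewrite (le_trans moment_base_ge1)// le_powR1// moment_base_ge1.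
have G0 : (0 <= G)%R by rewrite (le_trans _ G1).
have p0 : (0 <= p)%R by rewrite (le_trans _ (ltW p1)).
have b0 : (0 <= b)%R by rewrite (le_trans _ b1).
have b21 : (1 <= 2 * b)%R by move: b1; lra.
have [N] := ubnP #|L|; elim: N L => // N IHN L; rewrite ltnS => LN.
pose Z L := \sum_(J : {set 'I_m} | J \subset L) (q ^+ #|J|)%:E * max_moment J J.
have Z0 A : 0 <= Z A by apply: sume_ge0 => J _; rewrite mule_ge0 ?max_moment_ge0.
have ZS A B : A \subset B -> Z A <= Z B.
  move=> AB; rewrite /Z [leLHS]big_mkcond [leRHS]big_mkcond/=.
  apply: lee_sum => J _; case: ifPn => [JA|_].
    by rewrite (fintype.subset_trans JA AB).
  by case: ifP => // _; rewrite mule_ge0 ?max_moment_ge0.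
rewrite -/(Z L).
set c := ((4 * expR 1) `^ p)%R.
have c1 : (1 <= c)%R.
  have e1 : (1 <= 4 * expR 1 :> R)%R.
    have := expR1_ge1; lra.
  by rewrite (le_trans e1)// le_powR1.
have c0 : (0 <= c)%R by rewrite (le_trans _ c1).
have cardm A : (#|(A : {set 'I_m})| <= m)%N.
  by rewrite -[X in (_ <= X)%N]card_ord max_card.
have H J : J \subset L -> (q ^+ #|J|)%:E * max_moment J finset.set0 <=
    ((2 * b) ^+ m)%:E * ((q ^+ #|J|)%:E * max_moment J J +
      (m%:R * G ^+ #|L|)%:E * Z L).
  move=> JL; apply: (le_trans (max_moment_le (finset.sub0set J))).
  have S0 : 0 <= \sum_(j in J) full_moment (J :\ j).
    by apply: sume_ge0 => j _; exact: full_moment_ge0.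
  apply: (@le_trans _ _ (((2 * b) ^+ m)%:E * ((q ^+ #|J|)%:E * max_moment J J +
     \sum_(j in J) full_moment (J :\ j)))).
    rewrite lee_wpmul2r ?adde_ge0 ?mule_ge0 ?max_moment_ge0// lee_fin.
    by rewrite ler_weXn2l.
  rewrite lee_wpmul2l ?lee_fin ?exprn_ge0 ?mulr_ge0// leeD2l//.
  apply: (@le_trans _ _ (\sum_(j in J) (G ^+ #|L|)%:E * Z L)).
    apply: lee_sum => j jJ.
    have J'L : (#|J :\ j| < #|L|)%N.
      by rewrite (leq_trans _ (subset_leq_card JL))// (cardsD1 j J) jJ.
    apply: (le_trans (IHN _ (leq_trans J'L LN))).
    rewrite lee_pmul ?lee_fin ?exprn_ge0 ?Z0//; first by rewrite ler_weXn2l.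
    by apply: ZS; rewrite (fintype.subset_trans _ JL)// subD1set.
  apply: (@le_trans _ _ (\sum_(j : 'I_m) (G ^+ #|L|)%:E * Z L)).
    rewrite [leLHS]big_mkcond/=; apply: lee_sum => j _; case: ifP => // _.
    by rewrite mule_ge0 ?lee_fin ?exprn_ge0.
  rewrite EFinM -muleA mule_natl sumr_const card_ord; exact: lexx.
rewrite full_momentE -[leLHS]mul1e.
have d0 : [disjoint finset.set0 & L]%B by apply: eq_disjoint0 => j; rewrite inE.
have := split_moment_le d0.
rewrite cards0 expr0 finset.set0U => /le_trans; apply.
apply: (@le_trans _ _ ((c ^+ m)%:E * \sum_(J : {set 'I_m} | J \subset L)
  ((2 * b) ^+ m)%:E * ((q ^+ #|J|)%:E * max_moment J J +
      (m%:R * G ^+ #|L|)%:E * Z L))).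
  rewrite lee_pmul ?lee_fin ?exprn_ge0//.
  - by apply: sume_ge0 => J _; rewrite mule_ge0 ?max_moment_ge0.
  - by rewrite ler_weXn2l.
  - under eq_bigl do rewrite finset.sub0set /=.
    by apply: lee_sum => J JL; exact: H.
have mGZ : 0 <= (m%:R * G ^+ #|L|)%:E * Z L.
  by rewrite mule_ge0 ?lee_fin ?mulr_ge0 ?exprn_ge0.
rewrite -ge0_sume_distrr; last first.
  by move=> J _; rewrite adde_ge0// mule_ge0 ?max_moment_ge0.
rewrite big_split/= -/(Z L).
apply: (@le_trans _ _ ((c ^+ m)%:E * (((2 * b) ^+ m)%:E *
   ((1 + #|{set 'I_m}|%:R * m%:R)%:E * ((G ^+ #|L|)%:E * Z L))))).
  rewrite !lee_wpmul2l ?lee_fin ?exprn_ge0 ?mulr_ge0//.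
  rewrite EFinD ge0_muleDl ?lee_fin ?mulr_ge0// mul1e leeD//.
    by rewrite -[leLHS]mul1e lee_wpmul2r// lee_fin exprn_ege1.
  apply: (@le_trans _ _ (\sum_(J : {set 'I_m}) (m%:R * G ^+ #|L|)%:E * Z L)).
    by rewrite [leLHS]big_mkcond/=; apply: lee_sum => j _; case: ifP.
  apply: (@le_trans _ _ (#|{set 'I_m}|%:R%:E * ((m%:R * G ^+ #|L|)%:E * Z L))).
    by rewrite sumr_const mule_natl; exact: lexx.
  by rewrite !muleA -!EFinM mulrA.
rewrite !muleA lee_wpmul2r// -!EFinM lee_fin exprS ler_wpM2r ?exprn_ge0//.
rewrite /G /moment_base !powRM ?mulr_ge0 ?exprn_ge0 ?addr_ge0 ?mulr_ge0 ?expR_ge0//.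
rewrite !powR_exprn ?mulr_ge0 ?exprn_ge0 ?expR_ge0// -/c.
rewrite ler_pM ?mulr_ge0 ?exprn_ge0 ?addr_ge0 ?mulr_ge0//; last first.
  by rewrite le_powR1// lerDl mulr_ge0.
rewrite ler_wpM2l ?exprn_ge0// lerXn2r ?nnegrE ?mulr_ge0 ?powR_ge0//.
by rewrite [leRHS]powRM ?mulr_ge0 ?exprn_ge0// ler_wpM2r// le_powR1// ler1n.
Qed.

End kernels.

(** * Paley-Zygmund and the quantile *)

Section moments_of_random_variable.
Context {d : measure_display} {T : measurableType d} {R : realType}.
Variables (P : probability T R) (Y : T -> R) (p : R).
Hypotheses (mY : measurable_fun setT Y) (Y0 : forall w, 0 <= Y w) (p1 : 1 < p).

Let p0 : 0 < p. Proof. exact: lt_trans p1. Qed.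

Let conj_p : p^-1 + (p / (p - 1))^-1 = 1.
Proof. by rewrite invf_div mulrBl mulfV ?gt_eqF// mul1r addrC subrK. Qed.

Let q0 : 0 < p / (p - 1).
Proof. by rewrite divr_gt0// subr_gt0. Qed.

Lemma integral_mul_le (Z : T -> R) : measurable_fun setT Z ->
  (forall w, 0 <= Z w) ->
  (\int[P]_w (Y w * Z w)%:E <=
   (\int[P]_w (Y w `^ p)%:E) `^ p^-1 *
   (\int[P]_w (Z w `^ (p / (p - 1)))%:E) `^ ((p - 1) / p))%E.
Proof.
move=> mZ Z0; have := hoelder P mY mZ p0 q0 conj_p.
rewrite Lnorm1.
have -> : (\int[P]_w `|(EFin \o (Y \* Z)%R) w| = \int[P]_w (Y w * Z w)%:E)%E.
  by apply: eq_integral => w _ /=; rewrite ger0_norm// mulr_ge0.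
have NE (f : T -> R) r : 0 < r -> (forall w, 0 <= f w) ->
    ('N[P]_r%:E[EFin \o f] = (\int[P]_w (f w `^ r)%:E) `^ r^-1)%E.
  move=> r0 f0; rewrite Lnorm.unlock.
  apply: (congr1 (fun z => (z `^ r^-1)%E)).
  by apply: eq_integral => w _ /=; rewrite ger0_norm.
by rewrite !NE// invf_div.
Qed.

Lemma jensen_powR :
  ((\int[P]_w (Y w)%:E) `^ p <= \int[P]_w (Y w `^ p)%:E)%E.
Proof.
have := @integral_mul_le (cst 1) (measurable_cst _) (fun=> ler01).
have -> : (\int[P]_w (Y w * cst 1 w)%:E = \int[P]_w (Y w)%:E)%E.
  by apply: eq_integral => w _; rewrite mulr1.
have -> : (\int[P]_w (cst (1 : R) w `^ (p / (p - 1)))%:E = 1)%E.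
  under eq_integral do rewrite /= powR1.
  by rewrite integral_cst// mul1e; exact: probability_setT.
rewrite poweR1r mule1 => YN.
apply: (@le_trans _ _ (((\int[P]_w (Y w `^ p)%:E) `^ p^-1) `^ p)%E).
  rewrite le_poweR ?(ltW p0)//.
  by apply: integral_ge0 => w _; rewrite lee_fin.
rewrite -poweRrM mulVf ?gt_eqF// poweRe1//.
by apply: integral_ge0 => w _; rewrite lee_fin powR_ge0.
Qed.

Lemma markov_powR (t : R) : 0 < t ->
  ((t `^ p)%:E * P [set w | (t < Y w)%R] <= \int[P]_w (Y w `^ p)%:E)%E.
Proof.
move=> t0; have mE : measurable [set w | (t < Y w)%R].
  rewrite -[X in measurable X]setTI; apply: (@measurable_fun_ltr _ _ _ setT (cst t) Y) => //.
rewrite -(setIT [set w | _]) -integral_indic// -ge0_integralZl//; last 2 first.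
- exact/measurable_EFinP/measurable_indic.
- by rewrite lee_fin powR_ge0.
apply: ge0_le_integral => //.
- by move=> w _; rewrite mule_ge0 ?lee_fin ?powR_ge0.
- by apply: measurable_funeM; exact/measurable_EFinP/measurable_indic.
- by apply/measurable_EFinP; exact: (measurableT_comp (measurable_powR p)).
move=> w _; rewrite indicE; case: (boolP (w \in _)) => [|_].
  rewrite inE => /= tY; rewrite mule1 lee_fin ge0_ler_powR ?nnegrE ?(ltW p0)// ?(ltW t0)//.
  exact: ltW.
by rewrite mule0 lee_fin powR_ge0.
Qed.

(** Split E Y at level t: A <= t + E(Y; Y > t), and Hölder bounds the last term by V^(1/p) P(Y >
    t)^((p-1)/p). The threshold is the value that makes this at most A / 2 when V <= 2 K^p A^p. *)
Lemma paley_zygmund (K t A V : R) : 0 < K -> 0 <= t ->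
  (\int[P]_w (Y w)%:E = A%:E)%E -> (\int[P]_w (Y w `^ p)%:E = V%:E)%E ->
  V <= 2 * K `^ p * A `^ p ->
  (P [set w | (t < Y w)%R] <= (1 / (2 `^ ((p + 1) / (p - 1)) * K `^ (p / (p - 1))))%:E)%E ->
  A / 2 <= t.
Proof.
move=> K0 t0 EA EV VKA; set thr := 1 / _ => Pthr.
have mE : measurable [set w | (t < Y w)%R].
  rewrite -[X in measurable X]setTI.
  by apply: (@measurable_fun_ltr _ _ _ setT (cst t) Y) => //; exact: measurable_cst.
have q1 : 0 <= (p - 1) / p by rewrite divr_ge0 ?(ltW p0)// subr_ge0 ltW.
have A0 : 0 <= A.
  by rewrite -lee_fin -EA; apply: integral_ge0 => w _; rewrite lee_fin.
have V0 : 0 <= V.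
  by rewrite -lee_fin -EV; apply: integral_ge0 => w _; rewrite lee_fin powR_ge0.
have thr0 : 0 <= thr by rewrite divr_ge0// mulr_ge0 ?powR_ge0.
have mI : measurable_fun setT (\1_[set w | (t < Y w)%R] : T -> R) by exact: measurable_indic.
have YI0 w : (0 <= (Y w * \1_[set w | (t < Y w)%R] w)%:E)%E.
  by rewrite lee_fin mulr_ge0.
have mYI : measurable_fun setT (fun w => (Y w * \1_[set w | (t < Y w)%R] w)%:E).
  by apply/measurable_EFinP; exact: measurable_funM.
have tE : (\int[P]_w (t%:E + (Y w * \1_[set w | (t < Y w)%R] w)%:E) =
    t%:E + \int[P]_w (Y w * \1_[set w | (t < Y w)%R] w)%:E)%E.
  rewrite ge0_integralD//.
  rewrite integral_cst// [X in (_ * X)%E](_ : _ = 1%E) ?mule1//.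
  exact: probability_setT.
have YtI : (A%:E <= t%:E + \int[P]_w (Y w * \1_[set w | (t < Y w)%R] w)%:E)%E.
  rewrite -EA -tE; apply: ge0_le_integral => //.
  - by move=> w _; rewrite lee_fin.
  - exact/measurable_EFinP.
  - by apply: emeasurable_funD => //; exact: measurable_cst.
  move=> w _; rewrite indicE; case: (boolP (w \in _)) => [_|].
    by rewrite mulr1 -EFinD lee_fin lerDr.
  by rewrite notin_setE => /= /negP; rewrite -leNgt mulr0 adde0 lee_fin.
have h := @integral_mul_le _ mI (fun w => ler0n _ _).
have IE : (\int[P]_w (\1_[set w | (t < Y w)%R] w `^ (p / (p - 1)) : R)%:E =
    P [set w | (t < Y w)%R])%E.
  rewrite -[in RHS](setIT [set w | _]) -integral_indic//.
  apply: eq_integral => w _; rewrite indicE.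
  by case: (w \in _); rewrite ?powR1// powR0// gt_eqF.
rewrite IE EV in h.
have {h} Ah : A <= t + V `^ p^-1 * thr `^ ((p - 1) / p).
  rewrite -lee_fin EFinD; apply: le_trans YtI _.
  rewrite leeD2l// (le_trans h)// EFinM -!poweR_EFin lee_wpmul2l ?poweR_ge0//.
  by rewrite le_poweR.
(* The threshold is z^(-p/(p-1)), so Hölder's exponent turns it into 1/z, and 2^((p+1)/p) = 2 *
   2^(1/p) leaves exactly the factor 1/2. *)
pose z : R := 2 `^ ((p + 1) / p) * K.
have z0 : 0 < z by rewrite mulr_gt0 ?powR_gt0.
have p1_neq0 : p - 1 != 0 by rewrite subr_eq0 gt_eqF.
have p_neq0 : p != 0 by rewrite gt_eqF.
have thrE : thr `^ ((p - 1) / p) = z^-1.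
  have -> : thr = z `^ (- (p / (p - 1))).
    rewrite powRN /z powRM ?powR_ge0 ?(ltW K0)// -powRrM /thr div1r.
    by congr (2 `^ _ * _)^-1; field; rewrite p_neq0 p1_neq0.
  rewrite -powRrM (_ : _ * _ = -1) ?powR_inv1 ?(ltW z0)//.
  by field; rewrite p_neq0 p1_neq0.
have VE : V `^ p^-1 <= 2 `^ p^-1 * K * A.
  have KA0 : 0 <= 2 `^ p^-1 * K * A by rewrite !mulr_ge0 ?powR_ge0 ?(ltW K0).
  have -> : 2 `^ p^-1 * K * A = ((2 `^ p^-1 * K * A) `^ p) `^ p^-1.
    by rewrite -powRrM mulfV// powRr1.
  rewrite ge0_ler_powR ?invr_ge0 ?(ltW p0) ?nnegrE ?powR_ge0//.
  rewrite !powRM ?mulr_ge0 ?powR_ge0 ?(ltW K0)// -powRrM mulVf// powRr1//.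
have : V `^ p^-1 * thr `^ ((p - 1) / p) <= A / 2.
  rewrite thrE ler_pdivrMr//; apply: le_trans VE _.
  rewrite /z (_ : (p + 1) / p = 1 + p^-1); last by field.
  rewrite powRD ?powRr1//; last by rewrite (_ : 2 != 0) ?implybT// gt_eqF.
  by rewrite le_eqVlt; apply/orP; left; apply/eqP; field; rewrite ?gt_eqF ?powR_gt0.
by move: Ah; lra.
Qed.

Section quantile.
Variables (thr V : R).
Hypotheses (thr0 : 0 < thr) (EV : (\int[P]_w (Y w `^ p)%:E = V%:E)%E).

Let Q := [set t : R | 0 <= t /\ (P [set w | (t < Y w)%R] <= thr%:E)%E].

Let V0 : 0 <= V.
Proof.
by rewrite -lee_fin -EV; apply: integral_ge0 => w _; rewrite lee_fin powR_ge0.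
Qed.

Let in_quantile t : 0 < t -> V <= thr * t `^ p -> Q t.
Proof.
move=> t0 Vt; split; first exact: ltW.
have tp0 : 0 < t `^ p by rewrite powR_gt0.
have := markov_powR t0; rewrite EV => /le_trans/(_ (_ : _ <= (thr * t `^ p)%:E)%E).
rewrite lee_fin => /(_ Vt); rewrite EFinM muleC lee_pmul2r//.
Qed.

(** The level at which Markov's bound V / t^p equals [thr]. Only t > s is used below, which keeps t
    positive even when V = 0. *)
Let s := (V / thr) `^ p^-1.

Let s_gt t : s < t -> Q t.
Proof.
move=> st; have t0 : 0 < t by rewrite (le_lt_trans _ st) ?powR_ge0.
apply: in_quantile => //; rewrite -ler_pdivrMl// mulrC.
have Vt0 : 0 <= V / thr by rewrite divr_ge0 ?(ltW thr0).
have -> : V / thr = s `^ p by rewrite -powRrM mulVf ?gt_eqF// powRr1.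
by rewrite ge0_ler_powR ?nnegrE ?powR_ge0 ?(ltW p0) ?(ltW t0) ?(ltW st).
Qed.

(** Rules out the default value that [inf] takes on the empty set. *)
Lemma quantile_nonempty : Q !=set0.
Proof. by exists (s + 1); apply: s_gt; rewrite ltrDl. Qed.

Lemma quantile_ge0 : 0 <= inf Q.
Proof. by apply: lb_le_inf; [exact: quantile_nonempty|move=> t []]. Qed.

Lemma quantile_powR_le : thr * inf Q `^ p <= V.
Proof.
have Qs : inf Q <= s.
  rewrite leNgt; apply/negP => sQ.
  (* Otherwise this midpoint would be an element of [Q] below its infimum. *)
  have sQ2 : s < (s + inf Q) / 2 by lra.
  have := @ge_inf _ Q _ _ (s_gt sQ2).
  have lQ : has_lbound Q by exists 0 => t [].
  move=> /(_ lQ); lra.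
rewrite -ler_pdivlMl// mulrC.
have Vt0 : 0 <= V / thr by rewrite divr_ge0 ?(ltW thr0).
have -> : V / thr = s `^ p by rewrite -powRrM mulVf ?gt_eqF// powRr1.
by rewrite ge0_ler_powR ?nnegrE ?powR_ge0 ?(ltW p0) ?quantile_ge0.
Qed.

End quantile.

End moments_of_random_variable.

(** * Decoupled kernels *)

Section decoupled_kernels.
Context {d d' : measure_display} {T : measurableType d} {S : measurableType d'}.
Context {R : realType} (P : probability T R) {m n : nat}.
Variables (X : 'I_m -> 'I_n -> {RV P >-> S}) (h : multi_index m n -> m.-tuple S -> R).
Local Notation I := ('I_m * 'I_n)%type.
Hypothesis mh : forall i, measurable_fun setT (h i).
Hypothesis h0 : forall i s, 0 <= h i s.
Variables (i0 : multi_index m n) (x0 : 'I_m -> 'I_n -> S).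

Definition kernel_at (l : multi_index m n) (x : config I S) : \bar R :=
  (h_at h l (fun j k => x (j, k)))%:E.

Local Notation X' := (fun ji : I => X ji.1 ji.2).
Local Notation x0' := (fun ji : I => x0 ji.1 ji.2).

Lemma nneg_measurable_kernel_at l : nneg_measurable (kernel_at l).
Proof.
split; last by move=> x; rewrite lee_fin; exact: h0.
apply/measurable_EFinP; apply: (measurableT_comp (mh l)).
apply/measurable_fun_tnthP => j.
rewrite (_ : _ \o _ = fun x : config I S => x (j, l j)); first exact: measurable_coord.
by apply/funext => x /=; rewrite tnth_mktuple.
Qed.

Lemma depends_on_kernel_at (l : multi_index m n) :
  depends_on [set ji : I | ji.2 == l ji.1]%SET (kernel_at l).
Proof.
move=> x y xy; rewrite /kernel_at /h_at; congr (h l _)%:E.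
by apply: eq_from_tnth => j; rewrite !tnth_mktuple; apply: xy; rewrite inE.
Qed.

Lemma E_overE (J : {set 'I_m}) (F : ('I_m -> 'I_n -> S) -> \bar R) x :
  E_over X J F x =
  EE X' J (fun y => F (fun j k => y (j, k))) (fun ji => x ji.1 ji.2).
Proof.
apply: eq_integral => w _; congr F; apply/funext => j; apply/funext => k.
by rewrite /mix inE.
Qed.

Lemma mixed_momentE (p : R) J :
  mixed_moment X h p i0 x0 J = max_moment X' kernel_at i0 x0' p J J.
Proof.
rewrite /mixed_moment E_overE /max_moment; congr (EE _ _ _ _).
apply/funext => x; rewrite finset.setDv sum_over0 max_overE; last first.
  by move=> k; exact: poweR_ge0.
apply: eq_bigr => k _; congr poweR; apply: eq_bigr => l _.
by rewrite E_overE; congr (EE _ _ _ _); apply/funext => -[].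
Qed.

Lemma EE_setT F x : EE X' [set: 'I_m]%SET F x = (\int[P]_w F (sample X' w))%E.
Proof.
apply: eq_integral => w _; congr F.
have -> : slab (n := n) [set: 'I_m]%SET = [set: I]%SET.
  by apply/setP => ji; rewrite !inE.
exact: mixT.
Qed.

Lemma EE_set0 F x : EE X' finset.set0 F x = F x.
Proof.
rewrite /EE (_ : slab _ = finset.set0) ?average_set0//.
by apply/setP => ji; rewrite !inE.
Qed.

Let total (x : config I S) : R := \sum_l h_at h l (fun j k => x (j, k)).

Let total_ge0 x : 0 <= total x.
Proof. by apply: sumr_ge0 => l _; exact: h0. Qed.

Let totalE i x : partial_sum X' kernel_at [set: 'I_m]%SET finset.set0 i x = (total x)%:E.
Proof.
rewrite /partial_sum /sum_over /total -sumEFin; apply: eq_big => l.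
  by rewrite -/(agree _ _ _) agreeT.
by move=> _; rewrite EE_set0.
Qed.

Let nneg_measurable_total : nneg_measurable (fun x : config I S => (total x)%:E).
Proof.
have -> : (fun x : config I S => (total x)%:E) =
    partial_sum X' kernel_at [set: 'I_m]%SET finset.set0 i0.
  by apply/funext => x; rewrite totalE.
by apply: nneg_measurable_partial_sum; exact: nneg_measurable_kernel_at.
Qed.

Lemma full_moment_setT (p : R) : full_moment X' kernel_at i0 x0' p [set: 'I_m]%SET =
  (\int[P]_w (h_sum X h w `^ p)%:E)%E.
Proof.
rewrite /full_moment EE_setT finset.setCT.
by apply: eq_integral => w _; rewrite totalE.
Qed.

Lemma measurable_h_sum : measurable_fun setT (h_sum X h).
Proof.
apply: measurable_sum => l; apply: (measurableT_comp (mh l)).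
exact: measurable_selected.
Qed.

Lemma h_sum_ge0 w : 0 <= h_sum X h w.
Proof. by apply: sumr_ge0 => l _; exact: h0. Qed.

Hypothesis indepX : mutually_independent P (fun ji : I => X' ji : T -> S).

(** The empty set gives the one term of [full_moment_le] absent from the theorem; it has to be
    traded for t_0. *)
Lemma max_moment_set0 (p : R) :
  max_moment X' kernel_at i0 x0' p finset.set0 finset.set0 =
  ((\int[P]_w (h_sum X h w)%:E) `^ p)%E.
Proof.
rewrite /max_moment finset.setDv EE_set0 sum_over0 max0_over0 ?poweR_ge0//.
congr poweR; rewrite finset.setC0 -[X in partial_sum _ _ _ X](finset.setU0).
rewrite -EE_partial_sum//; last 2 first.
- exact: nneg_measurable_kernel_at.
- by rewrite disjoint_sym; apply: eq_disjoint0 => j; rewrite inE.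
by rewrite EE_setT; apply: eq_integral => w _; rewrite totalE.
Qed.

(** By nonnegativity the inner sum is at most the average of the total over the blocks outside [J],
    which no longer depends on i_J and so bounds the maximum. Jensen moves the power inside that
    average. *)
Lemma max_moment_le_full_moment (p : R) J : 1 < p ->
  (max_moment X' kernel_at i0 x0' p J J <=
   full_moment X' kernel_at i0 x0' p [set: 'I_m]%SET)%E.
Proof.
move=> p1; have mk := nneg_measurable_kernel_at.
have mt r : nneg_measurable (fun x : config I S => (total x `^ r)%:E).
  exact: (nneg_measurable_powR r nneg_measurable_total).
rewrite /full_moment finset.setCT.
have dJ : [disjoint J & ~: J]%B.
  by rewrite -setI_eq0; apply/eqP/setP => b; rewrite !inE andbN.
have -> : EE X' [set: 'I_m]%SET (fun x => (partial_sum X' kernel_at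
    [set: 'I_m]%SET finset.set0 i0 x `^ p)%E) x0' =
    EE X' J (EE X' (~: J) (fun x => (total x `^ p)%:E)) x0'.
  rewrite EE_EE// finset.setUCr; congr (EE _ _ _ _).
  by apply/funext => x; rewrite totalE.
rewrite /max_moment finset.setDv; apply: average_le.
- apply: nneg_measurable_sum_over => i; apply: nneg_measurable_max0_over => l.
  by apply: nneg_measurable_powR; exact: nneg_measurable_partial_sum.
- exact: nneg_measurable_EE.
move=> x; rewrite sum_over0.
have V0 : (0 <= EE X' (~: J) (fun y => (total y `^ p)%:E) x)%E.
  by apply: EE_ge0 => y; rewrite lee_fin powR_ge0.
apply: max0_over_le => // l _.
apply: (@le_trans _ _ (EE X' (~: J) (fun y => (total y)%:E) x `^ p)%E); last first.
  have [mY _] := nneg_measurable_mix X' (slab (~: J)) x nneg_measurable_total.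
  apply: jensen_powR => [|w|//]; first exact/measurable_EFinP.
  exact: total_ge0.
rewrite le_poweR ?(le_trans ler01) ?(ltW p1)//; first exact: partial_sum_ge0.
have -> : EE X' (~: J) (fun y => (total y)%:E) x =
    partial_sum X' kernel_at [set: 'I_m]%SET (~: J) i0 x.
  rewrite -[in RHS](finset.setU0 (~: J)) -EE_partial_sum//; last first.
    by rewrite disjoint_sym; apply: eq_disjoint0 => j; rewrite inE.
  by congr (EE _ _ _ _); apply/funext => y; rewrite totalE.
rewrite /partial_sum /sum_over [leLHS]big_mkcond [leRHS]big_mkcond/=.
apply: lee_sum => k _; rewrite -/(agree _ _ _) -/(agree _ k i0) agreeT.
by case: ifP => // _; apply: EE_ge0; exact: (mk k).2.
Qed.

(** Integrability is assumed for each [h i] under the law of its own arguments; a change of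
    variables and the crude bound carry it over to the sum. *)
Lemma integral_h_sum_lty (p : R) : 1 < p ->
  (forall i, (distribution P (selected X i)).-integrable setT
     (fun s => (h i s `^ p)%:E)) ->
  (\int[P]_w (h_sum X h w `^ p)%:E < +oo)%E.
Proof.
move=> p1 hint; have p0 : 0 < p by exact: lt_trans p1.
pose f l w := (h l (selected X l w) `^ p)%:E.
have mf l : nneg_measurable (f l).
  split; last by move=> w; rewrite lee_fin powR_ge0.
  apply/measurable_EFinP; apply: (measurableT_comp (measurable_powR p)).
  by apply: (measurableT_comp (mh l)); exact: measurable_selected.
have flty l : (\int[P]_w f l w < +oo)%E.
  have /integrableP[_] := hint l.
  rewrite ge0_integral_distribution//; last first.
    by apply: measurableT_comp => //; exact: (measurable_int _ (hint l)).
  apply: le_lt_trans; rewrite le_eqVlt; apply/orP; left; apply/eqP.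
  by apply: eq_integral => w _ /=; rewrite ger0_norm// powR_ge0.
pose N := (#|multi_index m n|%:R `^ p : R).
have N0 : 0 <= N by exact: powR_ge0.
apply: (@le_lt_trans _ _ (\int[P]_w (N%:E * \sum_l f l w))%E).
  apply: ge0_le_integral => //.
  - by move=> w _; rewrite lee_fin powR_ge0.
  - apply/measurable_EFinP; apply: (measurableT_comp (measurable_powR p)).
    exact: measurable_h_sum.
  - by apply: measurable_funeM; exact: (nneg_measurable_sum _ _ mf).1.
  move=> w _; rewrite -poweR_EFin /h_sum -sumEFin.
  by apply: poweR_sum_le => // l; rewrite lee_fin; exact: h0.
have [msf sf0] := nneg_measurable_sum (index_enum (multi_index m n)) xpredT mf.
rewrite ge0_integralZl ?lee_fin//.
rewrite ge0_integral_sum; last 3 first.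
- exact: measurableT.
- by move=> l; exact: (mf l).1.
- by move=> l w _; exact: (mf l).2.
by rewrite lte_mul_pinfty ?lee_fin// lte_sum_pinfty.
Qed.

End decoupled_kernels.

(** * Combination of the estimates and comparison of constants *)

Unset Implicit Arguments.

Theorem theorem2p3 (R : realType) (m : nat) (hm : (0 < m)%N) :
  exists K : R, 0 < K /\
  forall (d d' : measure_display) (T : measurableType d)
    (S : measurableType d') (P : probability T R) (n : nat)
    (X : 'I_m -> 'I_n -> {RV P >-> S}) (p : R)
    (h : multi_index m n -> m.-tuple S -> R),
  (m <= n)%N ->
  mutually_independent P (fun ji : 'I_m * 'I_n => X ji.1 ji.2 : T -> S) ->
  1 < p ->
  (forall i, measurable_fun setT (h i)) ->
  (forall i s, 0 <= h i s) ->
  (forall i, (distribution P (selected X i)).-integrable setT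
     (fun s => (h i s `^ p)%:E)) ->
  forall (i0 : multi_index m n) (x0 : 'I_m -> 'I_n -> S),
  let t0 := t_zero X h p K in
  (maxe (1 / (4 * K) `^ (p / (p - 1)) * t0 `^ p)%:E
     (\big[maxe/-oo]_(J : {set 'I_m} | J != finset.set0) mixed_moment X h p i0 x0 J)
   <= 'E_P[fun w => (h_sum X h w `^ p)%R])%E
  /\
  ('E_P[fun w => (h_sum X h w `^ p)%R]
   <= ((4 * K) `^ p)%:E *
      ((2 `^ (1 + p) * t0 `^ p)%:E +
       \sum_(J : {set 'I_m} | J != finset.set0)
         (p `^ (#|J|%:R * p))%:E * mixed_moment X h p i0 x0 J))%E.
Proof.
(* [full_moment_le] on the full set of places costs the p-th power of [moment_base] to the power m +
   1. *)
pose K : R := moment_base (R := R) (m := m) ^+ m.+1.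
have K1 : 1 <= K by rewrite exprn_ege1// moment_base_ge1.
have K0 : 0 < K by rewrite (lt_le_trans _ K1).
exists K; split=> // d d' T S P n X p h _ indepX p1 mh h0 hint i0 x0 t0.
have p0 : 0 < p by exact: lt_trans p1.
have p1_gt0 : 0 < p - 1 by rewrite subr_gt0.
have b0 : 0 <= moment_base (R := R) (m := m).
  by rewrite (le_trans ler01)// moment_base_ge1.
have mS := measurable_h_sum X mh.
have S0 := h_sum_ge0 X h0.
have -> : ('E_P[fun w => (h_sum X h w `^ p)%R] =
    \int[P]_w (h_sum X h w `^ p)%:E)%E by rewrite unlock.
have Vlty := integral_h_sum_lty mh h0 p1 hint.
have VM (J : {set 'I_m}) : (mixed_moment X h p i0 x0 J <=
    \int[P]_w (h_sum X h w `^ p)%:E)%E.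
  rewrite mixed_momentE -(full_moment_setT X h i0 x0).
  exact: max_moment_le_full_moment.
have M0 (J : {set 'I_m}) : (0 <= mixed_moment X h p i0 x0 J)%E.
  by rewrite mixed_momentE max_moment_ge0.
have upper : (\int[P]_w (h_sum X h w `^ p)%:E <= (K `^ p)%:E *
   ((\int[P]_w (h_sum X h w)%:E) `^ p +
    \sum_(J : {set 'I_m} | J != finset.set0)
         (p `^ (#|J|%:R * p))%:E * mixed_moment X h p i0 x0 J))%E.
  rewrite -(full_moment_setT X h i0 x0).
  have := full_moment_le indepX (nneg_measurable_kernel_at mh h0)
    (depends_on_kernel_at h) i0 (fun ji => x0 ji.1 ji.2) p1 [set: 'I_m]%SET.
  rewrite cardsT card_ord -powR_exprn// -/K.
  rewrite (bigD1 finset.set0)/= ?finset.sub0set// cards0 expr0 mul1e.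
  rewrite (max_moment_set0 mh h0 i0 x0 indepX).
  move=> /le_trans; apply; rewrite lee_wpmul2l ?lee_fin ?powR_ge0// leeD2l//.
  rewrite le_eqVlt; apply/orP; left; apply/eqP; apply: eq_big => J.
    by rewrite finset.subsetT.
  move=> _; rewrite mixed_momentE; congr (_%:E * _)%E.
  by rewrite -powR_mulrn ?powR_ge0// -powRrM mulrC.
have EV0 : (0 <= \int[P]_w (h_sum X h w `^ p)%:E)%E.
  by apply: integral_ge0 => w _; rewrite lee_fin powR_ge0.
have EA0 : (0 <= \int[P]_w (h_sum X h w)%:E)%E.
  by apply: integral_ge0 => w _; rewrite lee_fin.
have [V EV] : exists V, (\int[P]_w (h_sum X h w `^ p)%:E = V%:E)%E.
  by exists (fine (\int[P]_w (h_sum X h w `^ p)%:E)); rewrite fineK// ge0_fin_numE.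
have [A EA] : exists A, (\int[P]_w (h_sum X h w)%:E = A%:E)%E.
  exists (fine (\int[P]_w (h_sum X h w)%:E)); rewrite fineK// ge0_fin_numE//.
  have pn0 : p != 0 by rewrite gt_eqF.
  by apply: (lty_poweRy pn0); apply: le_lt_trans Vlty; exact: jensen_powR.
rewrite EV EA in upper VM EV0 EA0 *.
pose thr : R := 1 / (2 `^ ((p + 1) / (p - 1)) * K `^ (p / (p - 1))).
have thr0 : 0 < thr by rewrite divr_gt0// mulr_gt0// powR_gt0.
have t00 : 0 <= t0 by exact: (quantile_ge0 mS S0 p1 thr0 EV).
have t0V : thr * t0 `^ p <= V by exact: (quantile_powR_le mS S0 p1 thr0 EV).
have K40 : 0 < 4 * K by rewrite mulr_gt0.
split.
  rewrite ge_max; apply/andP; split.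
    rewrite lee_fin; apply: le_trans t0V; rewrite ler_wpM2r ?powR_ge0//.
    (* The threshold is at least (4 K)^(-p/(p-1)), since 4^(p/(p-1)) = 2^(2p/(p-1)) and p + 1 <= 2
       p. *)
    rewrite /thr !div1r lef_pV2 ?posrE ?mulr_gt0 ?powR_gt0//.
    rewrite powRM ?(ltW K0)// ler_wpM2r ?powR_ge0//.
    have -> : (4 : R) = 2 `^ 2 by rewrite powR_mulrn// -natrX.
    rewrite -powRrM ler_powR ?ler1n// mulrA ler_wpM2r ?invr_ge0 ?(ltW p1_gt0)//.
    by lra.
  by apply: bigmax_le => [|J _]; [exact: leNye|exact: VM].
set Z := (\sum_(J | _) _)%E in upper *.
have Z0 : (0 <= Z)%E.
  by apply: sume_ge0 => J _; rewrite mule_ge0 ?lee_fin ?powR_ge0.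
(* Keeping only the larger of the two terms of [upper] costs a factor 2, absorbed by 2 <= 4 <=
   4^p. *)
have K4 : 2 * K `^ p <= (4 * K) `^ p.
  rewrite powRM ?(ltW K0)// ler_wpM2r ?powR_ge0//.
  by apply: (@le_trans _ _ 4); [lra|apply: le_powR1 => //; lra].
have [AZ|/ltW ZA] := leP ((A%:E) `^ p)%E Z.
  apply: (le_trans upper); apply: (@le_trans _ _ ((2 * K `^ p)%:E * Z)%E).
    rewrite [X in (_ <= X * _)%E]EFinM muleC [leRHS]muleC muleA lee_wpmul2r ?lee_fin ?powR_ge0//.
    by rewrite muleC mule_natl mule2n leeD.
  rewrite lee_pmul ?lee_fin ?mulr_ge0 ?powR_ge0//.
  by rewrite leeDr// lee_fin mulr_ge0 ?powR_ge0.
have VKA : V <= 2 * K `^ p * A `^ p.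
  rewrite -lee_fin (le_trans upper)// -mulrA mulrCA !EFinM lee_wpmul2l ?lee_fin ?powR_ge0//.
  by rewrite mule_natl mule2n leeD.
(* Paley-Zygmund applies to each admissible t, so A / 2 is a lower bound of the set whose infimum is
   t_0. *)
have At0 : A / 2 <= t0.
  apply: lb_le_inf; first exact: (quantile_nonempty mS S0 p1 thr0 EV).
  move=> t [t_ge0 Pt]; exact: (paley_zygmund mS S0 p1 K0 t_ge0 EA EV VKA Pt).
apply: (@le_trans _ _ ((4 * K) `^ p * (2 `^ (1 + p) * t0 `^ p))%:E); last first.
  by rewrite EFinM lee_wpmul2l ?lee_fin ?powR_ge0// leeDl.
rewrite lee_fin (le_trans VKA)//.
have Ap : A `^ p <= 2 `^ (1 + p) * t0 `^ p.
  apply: (@le_trans _ _ ((2 * t0) `^ p)).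
    by rewrite ge0_ler_powR ?nnegrE ?(ltW p0) ?mulr_ge0//; move: EA0 At0; rewrite lee_fin; lra.
  rewrite powRM// ler_wpM2r ?powR_ge0// ler_powR ?ler1n//; lra.
by rewrite ler_pM ?mulr_ge0 ?powR_ge0.
Qed.
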